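(* Let $\beta(x)$ be a formal power series. Let $a, b$ be real-valued functions on the set of unlabeled rooted trees together with an extra empty object $\emptyset$, with $a(\emptyset) = 1$, and let $c = a * b$ be their subtree convolution. Then the corresponding weighted tree sums satisfy $$f^c(t,g) = f^b\big(t, f^a(t,g)\big)$$ as formal power series in $t$ (with coefficients formal power series in $g$).
   Context: A labeled rooted tree on a non-empty finite set $U$ consists of a root $r\in U$ and a function $T:U\setminus\{r\}\to U$ such that no non-empty $S\subseteq U\setminus\{r\}$ satisfies $T(S)\subseteq S$; $\mathcal{A}[U]$ is the set of these, $|T|=|U|$, and the degree of $j$ is $|T^{-1}(j)|$. Unlabeled rooted trees are isomorphism classes under relabeling, so a function $c$ on unlabeled rooted trees also gives values $c(T)$ on labeled rooted trees. For $j\in U$, $T_j$ denotes the restriction of $T$ to the set of $k$ with $T^m(k)=j$ for some $m\ge0$, a rooted tree with root $j$. A rooted subtree $T_0\to T$ is either the empty object, or the restriction of $T$ to a non-empty $U_0\subseteq U$ containing $r$ with $T(U_0\setminus\{r\})\subseteq U_0$. The difference forest $T\setminus T_0$ is the collection of trees $T_j$ with $j\in U\setminus U_0$ and $T(j)\in U_0$; if $T_0$ is the empty object it is $\{T\}$. For a forest $F$, $a^\times(F)=\prod_{T'\in F} a(T')$ (equal to $1$ for the empty forest). The subtree convolution $c=a*b$ (defined when $a(\emptyset)=1$) is $c(\emptyset)=b(\emptyset)$ and, for a rooted tree $T$, $c(T)=\sum_{T_0\to T} b(T_0)\,a^\times(T\setminus T_0)$, where the empty-subtree term is $b(\emptyset)a(T)$.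 For a coefficient function $c$, with $U_n$ any set of $n$ elements, $$f^c(t,g) = c(\emptyset)\,g + \sum_{n\ge1}\frac{t^n}{n!}\sum_{T\in\mathcal{A}[U_n]} c(T)\, f_T(g),\qquad f_T(g) = \prod_{\ell\in U_n}\beta^{(|T^{-1}(\ell)|)}(g).$$ The composite $f^b(t,f^a(t,g))$ is interpreted by substituting $f^a(t,g) = g + O(t)$ for $g$ and expanding in powers of $t$ (Taylor expansion around $g$). *)

(* Defs.v *)
From HB Require Import structures.
From mathcomp Require Import all_boot all_order all_algebra.
From mathcomp Require Import boolp reals.

Set Implicit Arguments.
Unset Strict Implicit.
Unset Printing Implicit Defensive.
Import GRing.Theory.
Local Open Scope ring_scope.

Record fps (R : Type) := Fps { coef_fps : nat -> R }.

Notation "f .[[ n ] ]" := (coef_fps f n)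
  (at level 1, n at level 99, left associativity, format "f .[[ n ] ]")
  : ring_scope.

HB.instance Definition _ (R : Type) := gen_eqMixin (fps R).
HB.instance Definition _ (R : Type) := gen_choiceMixin (fps R).

Lemma fpsP (R : Type) (f g : fps R) : (forall n, f.[[n]] = g.[[n]]) <-> f = g.
Proof.
split=> [|-> //]; case: f g => [f] [g] /= fg.
by congr Fps; apply/funext.
Qed.

Section FpsRing.
Context (R : comNzRingType).
Implicit Types f g h : fps R.

Definition fps_zero : fps R := Fps (fun=> 0).
Definition fps_opp f : fps R := Fps (fun n => - f.[[n]]).
Definition fps_add f g : fps R := Fps (fun n => f.[[n]] + g.[[n]]).
Definition fpsC (c : R) : fps R := Fps (fun n => if n == 0%N then c else 0).
Definition fpsX : fps R := Fps (fun n => (n == 1%N)%:R).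
Definition fps_mul f g : fps R :=
  Fps (fun n => \sum_(i < n.+1) f.[[i]] * g.[[n - i]]).
Definition fps_scale (c : R) f : fps R := Fps (fun n => c * f.[[n]]).

Lemma fps_addA : associative fps_add.
Proof. by move=> f g h; apply/fpsP => n /=; rewrite addrA. Qed.
Lemma fps_addC : commutative fps_add.
Proof. by move=> f g; apply/fpsP => n /=; rewrite addrC. Qed.
Lemma fps_add0 : left_id fps_zero fps_add.
Proof. by move=> f; apply/fpsP => n /=; rewrite add0r. Qed.
Lemma fps_addN : left_inverse fps_zero fps_opp fps_add.
Proof. by move=> f; apply/fpsP => n /=; rewrite addNr. Qed.

HB.instance Definition _ :=
  GRing.isZmodule.Build (fps R) fps_addA fps_addC fps_add0 fps_addN.

Let trunc N f : {poly R} := \poly_(i < N) f.[[i]].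

Let fps_mulE N f g n : (n < N)%N ->
  (fps_mul f g).[[n]] = (trunc N f * trunc N g)`_n.
Proof.
move=> nN; rewrite coefM; apply: eq_bigr => i _; rewrite !coef_poly.
by rewrite (leq_ltn_trans _ nN) ?(leq_ltn_trans (leq_subr _ _) nN) // -ltnS.
Qed.

Let trunc_mul N f g n : (n < N)%N ->
  (trunc N (fps_mul f g))`_n = (trunc N f * trunc N g)`_n.
Proof. by move=> nN; rewrite coef_poly nN (fps_mulE _ _ nN). Qed.

Lemma fps_mulC : commutative fps_mul.
Proof.
by move=> f g; apply/fpsP => n; rewrite !(fps_mulE _ _ (ltnSn n)) mulrC.
Qed.

Lemma fps_mulA : associative fps_mul.
Proof.
move=> f g h; apply/fpsP => n; rewrite !(fps_mulE _ _ (ltnSn n)).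
transitivity ((trunc n.+1 f * (trunc n.+1 g * trunc n.+1 h))`_n).
  rewrite !coefM; apply: eq_bigr => i _.
  by rewrite -trunc_mul // ltnS leq_subr.
by rewrite mulrA !coefM; apply: eq_bigr => i _; rewrite trunc_mul.
Qed.

Lemma fps_mul1 : left_id (fpsC 1) fps_mul.
Proof.
move=> f; apply/fpsP => n /=.
by rewrite big_ord_recl mul1r subn0 big1 ?addr0 // => i _; rewrite mul0r.
Qed.

Lemma fps_mulDl : left_distributive fps_mul +%R.
Proof.
move=> f g h; apply/fpsP => n /=; rewrite -big_split /=.
by apply: eq_bigr => i _; rewrite mulrDl.
Qed.

Lemma fps_oner_neq0 : fpsC 1 != 0.
Proof.
by apply/eqP => /fpsP /(_ 0%N) /eqP; rewrite /= oner_eq0.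
Qed.

HB.instance Definition _ := GRing.Zmodule_isComNzRing.Build (fps R)
  fps_mulA fps_mulC fps_mul1 fps_mulDl fps_oner_neq0.

Lemma fps_scaleA a b f : fps_scale a (fps_scale b f) = fps_scale (a * b) f.
Proof. by apply/fpsP => n /=; rewrite mulrA. Qed.
Lemma fps_scale1 : left_id 1 fps_scale.
Proof. by move=> f; apply/fpsP => n /=; rewrite mul1r. Qed.
Lemma fps_scaleDr : right_distributive fps_scale +%R.
Proof. by move=> c f g; apply/fpsP => n /=; rewrite mulrDr. Qed.
Lemma fps_scaleDl f : {morph fps_scale^~ f : a b / a + b}.
Proof. by move=> a b; apply/fpsP => n /=; rewrite mulrDl. Qed.

HB.instance Definition _ := GRing.Zmodule_isLmodule.Build R (fps R)
  fps_scaleA fps_scale1 fps_scaleDr fps_scaleDl.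

Lemma fps_scaleAl (a : R) f g : a *: (f * g) = (a *: f) * g.
Proof.
apply/fpsP => n /=; rewrite mulr_sumr.
by apply: eq_bigr => i _; rewrite mulrA.
Qed.

HB.instance Definition _ :=
  GRing.Lmodule_isLalgebra.Build R (fps R) fps_scaleAl.

Definition fps_deriv f : fps R := Fps (fun n => f.[[n.+1]] *+ n.+1).

End FpsRing.

Arguments fpsX {R}.

(** The series [f : fps (fps R)] stand for elements of R[[g]][[t]]: the outer
    variable is t and [f.[[n]]] is the coefficient of t^n, a series in g. *)

Lemma fps_exp_order (R : comNzRingType) (d : fps R) (k n : nat) :
  d.[[0]] = 0 -> (n < k)%N -> (d ^+ k).[[n]] = 0.
Proof.
move=> d0; elim: k n => // k IH n nk; rewrite exprS /=.
rewrite big_ord_recl d0 mul0r add0r big1 // => i _.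
case: n nk i => [_ []//|n nk i].
by rewrite IH ?mulr0 // lift0 subSS (leq_ltn_trans (leq_subr _ _)).
Qed.

Section Substitution.
Context (R : realType).

(** The Taylor expansion h(g + d) = \sum_k h^(k)(g) / k! d^k, for d = O(t).
    By [fps_exp_order], the coefficient of t^n in the sum only involves the
    terms with k <= n. *)
Definition fps_taylor (h : fps R) (d : fps (fps R)) : fps (fps R) :=
  Fps (fun n => \sum_(k < n.+1)
    (k`!%:R^-1 : R) *: (iter k (@fps_deriv R) h * (d ^+ k).[[n]])).

(** F(t, u(t, g)) = \sum_m t^m F_m(u(t, g)), for u(t, g) = g + O(t). *)
Definition fps_subst (F u : fps (fps R)) : fps (fps R) :=
  Fps (fun n => \sum_(m < n.+1)
    (fps_taylor F.[[m]] (u - fpsC fpsX)).[[n - m]]).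

End Substitution.

(** A function T : U \ {r} -> U is encoded by an option-valued function on U
    that takes the value [None] exactly at r. *)
Definition rtree_axiom (U : finType) (d : U * {ffun U -> option U}) : bool :=
  [forall k, (d.2 k == None) == (k == d.1)] &&
  [forall S : {set U}, (S != set0) && (d.1 \notin S) ==>
     ~~ (d.2 @: S \subset Some @: S)].

Record rtree (U : finType) := RTree {
  rtree_val : U * {ffun U -> option U};
  rtreeP : rtree_axiom rtree_val }.

HB.instance Definition _ (U : finType) := [isSub for @rtree_val U].
HB.instance Definition _ (U : finType) := [Finite of rtree U by <:].

Section LabeledTrees.
Context (U : finType).
Implicit Types (T : rtree U) (A : {set U}).

Definition root T : U := (rtree_val T).1.
Definition parent T (k : U) : option U := (rtree_val T).2 k.

Definition degree T (j : U) : nat := #|[set k | parent T k == Some j]|.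

(** [T] restricts to a rooted tree on [A] with root [j]. *)
Definition restrictable T A j : bool :=
  (j \in A) && (parent T @: (A :\ j) \subset Some @: A).

Definition restrict_val T A j (h : restrictable T A j) :
    {k | k \in A} * {ffun {k | k \in A} -> option {k | k \in A}} :=
  (exist _ j (proj1 (andP h)),
   [ffun k => if val k == j then None else obind insub (parent T (val k))]).

Lemma restrict_subproof T A j (h : restrictable T A j) :
  rtree_axiom (restrict_val h).
Proof.
have [jA /subsetP hA] := andP h; apply/andP; split.
  apply/forallP => -[k kA]; rewrite /= ffunE -val_eqE /=.
  have [//|kj] := eqVneq k j.
  have /hA/imsetP[l lA ->] : parent T k \in parent T @: (A :\ j).
    by rewrite imset_f // !inE kj kA.
  by rewrite /= insubT.
apply/forallP => S; apply/implyP => /andP[/set0Pn[k0 k0S] jS].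
have TP := rtreeP T; case/andP: TP => /forallP Troot /forallP Tacyc.
have valT k : k \in S -> exists2 l, l \in A & parent T (val k) = Some l.
  move=> kS; have /hA/imsetP[l lA ->] : parent T (val k) \in parent T @: (A :\ j).
    apply/imset_f; rewrite !inE (valP k) andbT.
    apply: contraNneq jS => kj; suff <- : k = (restrict_val h).1 by [].
    exact: val_inj.
  by exists l.
apply/negP => /subsetP sub.
have /implyP no := Tacyc (val @: S); refine (negP (no _) _).
  apply/andP; split; first by apply/set0Pn; exists (val k0); apply: imset_f.
  apply/imsetP => -[k kS rk]; have [l _] := valT _ kS.
  have /eqP := Troot (val k); rewrite -/(parent T _) -rk eqxx => /eqP.
  by move=> ->.
apply/subsetP => _ /imsetP[_ /imsetP[k kS ->] ->].
have [l lA Tk] := valT _ kS.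
have /sub/imsetP[m mS] : (restrict_val h).2 k \in (restrict_val h).2 @: S.
  exact: imset_f.
rewrite ffunE Tk /= insubT; case: ifP => // _ [] lm.
by rewrite -/(parent _ _) Tk imset_f //; apply/imsetP; exists m => //; rewrite -lm.
Qed.

Definition restrict T A j (h : restrictable T A j) : rtree {k | k \in A} :=
  RTree (restrict_subproof h).

Definition descendants T (j : U) : {set U} :=
  [set k | `[< exists m : nat, iter m (obind (parent T)) (Some k) = Some j >]].

Lemma branch_subproof T j : restrictable T (descendants T j) j.
Proof.
apply/andP; split; first by rewrite inE; apply/asboolP; exists 0%N.
apply/subsetP => _ /imsetP[k + ->].
rewrite !inE => /andP[kj /asboolP[[|m]]].
  by move=> [] /= kj'; rewrite kj' eqxx in kj.
rewrite iterSr /=; case: (parent T k) => [l|] hl.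
  by apply: imset_f; rewrite inE; apply/asboolP; exists m.
have none : iter m (obind (parent T)) None = None by elim: m {hl} => //= m ->.
by rewrite none in hl.
Qed.

Definition branch T j : rtree {k | k \in descendants T j} :=
  restrict (branch_subproof T j).

(** The non-empty rooted subtrees of T, given by their vertex sets. *)
Definition subtree T : Type := {A : {set U} | restrictable T A (root T)}.

HB.instance Definition _ T := Finite.on (subtree T).

End LabeledTrees.

Definition isomorphic (U V : finType) (T : rtree U) (T' : rtree V) : Prop :=
  exists s : U -> V, [/\ bijective s, root T' = s (root T) &
    forall k, parent T' (s k) = omap s (parent T k)].

(** The trees on a set of n elements for some n. There is none for n = 0. *)
Definition ord_rtree : Type := {n : nat & rtree 'I_n}.

HB.instance Definition _ := Choice.on ord_rtree.

Definition ord_rtree_iso : rel ord_rtree :=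
  fun x y => `[< isomorphic (tagged x) (tagged y) >].

Lemma isomorphic_refl (U : finType) (T : rtree U) : isomorphic T T.
Proof.
exists id; split=> //; first by exists id.
by move=> k; case: (parent T k).
Qed.

Lemma isomorphic_sym (U V : finType) (T : rtree U) (T' : rtree V) :
  isomorphic T T' -> isomorphic T' T.
Proof.
case=> s [[s' sK s'K] r p]; exists s'; split; first by exists s.
  by rewrite r sK.
by move=> k; rewrite -{2}(s'K k) p; case: parent => //= l; rewrite sK.
Qed.

Lemma isomorphic_trans (U V W : finType)
    (T : rtree U) (T' : rtree V) (T'' : rtree W) :
  isomorphic T T' -> isomorphic T' T'' -> isomorphic T T''.
Proof.
case=> s [bs r p] [s' [bs' r' p']]; exists (s' \o s); split.
- exact: bij_comp.
- by rewrite r' r.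
- by move=> k; rewrite /= p' p; case: parent.
Qed.

Lemma ord_rtree_iso_refl : reflexive ord_rtree_iso.
Proof. by move=> x; apply/asboolP/isomorphic_refl. Qed.

Lemma ord_rtree_iso_sym : symmetric ord_rtree_iso.
Proof. by move=> x y; apply/asboolP/asboolP => /isomorphic_sym. Qed.

Lemma ord_rtree_iso_trans : transitive ord_rtree_iso.
Proof.
move=> y x z /asboolP xy /asboolP yz; apply/asboolP.
exact: isomorphic_trans xy yz.
Qed.

Canonical ord_rtree_equiv :=
  EquivRel ord_rtree_iso ord_rtree_iso_refl ord_rtree_iso_sym
    ord_rtree_iso_trans.

Definition utree : Type := {eq_quot ord_rtree_iso}%qT.
HB.instance Definition _ := Choice.on utree.
HB.instance Definition _ := EqQuotient.on utree.

Section Unlabel.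
Context (U : finType).

Definition relabel_val (T : rtree U) :
    'I_#|U| * {ffun 'I_#|U| -> option 'I_#|U|} :=
  (enum_rank (root T),
   [ffun i => omap enum_rank (parent T (enum_val i))]).

Lemma relabel_subproof (T : rtree U) : rtree_axiom (relabel_val T).
Proof.
have /andP[/forallP Troot /forallP Tacyc] := rtreeP T; apply/andP; split.
  apply/forallP => i; rewrite /= ffunE -(inj_eq enum_val_inj) enum_rankK.
  by rewrite -(eqP (Troot (enum_val i))) -/(parent T _); case: parent.
apply/forallP => S; apply/implyP => /andP[/set0Pn[k0 k0S] rS].
apply/negP => /subsetP sub.
have /implyP no := Tacyc (enum_val @: S); refine (negP (no _) _).
  apply/andP; split; first by apply/set0Pn; exists (enum_val k0); apply: imset_f.
  by apply: contra rS => /imsetP[i iS]; rewrite /= -/(root T) => ->; rewrite enum_valK.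
apply/subsetP => _ /imsetP[_ /imsetP[i iS ->] ->].
have /sub/imsetP[l lS] : (relabel_val T).2 i \in (relabel_val T).2 @: S.
  exact: imset_f.
rewrite ffunE -/(parent T _); case: parent => //= k [kl].
by apply: imset_f; apply/imsetP; exists l; rewrite // -kl enum_rankK.
Qed.

Definition unlabel (T : rtree U) : utree :=
  \pi_utree%qT (Tagged (fun n => rtree 'I_n) (RTree (relabel_subproof T))).

End Unlabel.

Section Forests.
Context (U : finType) (T : rtree U).

(** In the following two definitions [None] is the empty subtree. *)
Definition subtree_class (T0 : option (subtree T)) : option utree :=
  omap (fun A : subtree T => unlabel (restrict (svalP A))) T0.

Definition difference_forest (T0 : option (subtree T)) : seq utree :=
  if T0 is Some A then
    [seq unlabel (branch T j) | j <- enum U &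
      (j \notin sval A) && (parent T j \in Some @: sval A)]
  else [:: unlabel T].

End Forests.

Section Convolution.
Context (R : realType).

(** A function on unlabeled rooted trees and the empty object [None]. *)
Implicit Types a b c : option utree -> R.

Definition forest_weight a (F : seq utree) : R := \prod_(t <- F) a (Some t).

Definition subtree_sum a b (U : finType) (T : rtree U) : R :=
  \sum_(T0 : option (subtree T))
    b (subtree_class T0) * forest_weight a (difference_forest T0).

(** The value at a class is computed on a representative; by
    [subtree_conv_unlabel] below it does not depend on it. *)
Definition subtree_conv a b : option utree -> R :=
  fun t => if t is Some t' then subtree_sum a b (tagged (repr t'))
           else b None.

End Convolution.

Section TreeSums.
Context (R : realType) (beta : fps R).

Definition tree_term (U : finType) (T : rtree U) : fps R :=
  \prod_(l : U) iter (degree T l) (@fps_deriv R) beta.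

Definition tree_series (c : option utree -> R) : fps (fps R) :=
  Fps (fun n => if n == 0%N then c None *: fpsX else
    (n`!%:R^-1 : R) *:
      \sum_(T : rtree 'I_n) c (Some (unlabel T)) *: tree_term T).

End TreeSums.

Lemma isomorphic_relabel (U : finType) (T : rtree U) :
  isomorphic T (RTree (relabel_subproof T)).
Proof.
exists enum_rank; split=> [|//|k]; first exact: enum_rank_bij.
by rewrite /parent /= ffunE enum_rankK.
Qed.

Lemma unlabelP (U V : finType) (T : rtree U) (T' : rtree V) :
  isomorphic T T' <-> unlabel T = unlabel T'.
Proof.
split=> [h|/eqmodP/asboolP h].
  apply/eqmodP/asboolP => /=.
  apply: isomorphic_trans (isomorphic_relabel T').
  exact: isomorphic_trans (isomorphic_sym (isomorphic_relabel T)) h.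
apply: isomorphic_trans (isomorphic_relabel T) _.
exact: isomorphic_trans h (isomorphic_sym (isomorphic_relabel T')).
Qed.

Lemma unlabel_repr (t : utree) : unlabel (tagged (repr t)) = t.
Proof.
rewrite -[RHS]reprK; apply/eqmodP/asboolP => /=.
exact/isomorphic_sym/isomorphic_relabel.
Qed.

Section Isomorphism.
Context (U V : finType) (T : rtree U) (T' : rtree V) (s : U -> V).
Context (s_bij : bijective s) (s_root : root T' = s (root T)).
Context (s_parent : forall k, parent T' (s k) = omap s (parent T k)).

Let s_inj : injective s := bij_inj s_bij.

Lemma restrictable_iso (A : {set U}) j :
  restrictable T A j -> restrictable T' (s @: A) (s j).
Proof.
case/andP=> jA /subsetP hA; rewrite /restrictable imset_f //=.
apply/subsetP => _ /imsetP[k' + ->]; rewrite !inE => /andP[kj /imsetP[k kA kk]].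
rewrite {}kk (inj_eq s_inj) s_parent in kj *.
have /hA/imsetP[l lA ->] : parent T k \in parent T @: (A :\ j).
  by rewrite imset_f // !inE kj.
by rewrite /= !imset_f.
Qed.

Lemma restrict_iso (A : {set U}) (A' : {set V}) j j'
    (h : restrictable T A j) (h' : restrictable T' A' j') :
  A' = s @: A -> j' = s j -> isomorphic (restrict h) (restrict h').
Proof.
move=> EA Ej; case: s_bij => s' sK s'K.
have sA k : k \in A -> s k \in A' by move=> kA; rewrite EA imset_f.
have s'A k : k \in A' -> s' k \in A.
  by rewrite EA => /imsetP[l lA ->]; rewrite sK.
exists (fun k => Sub (s (val k)) (sA _ (valP k))); split.
- exists (fun k => Sub (s' (val k)) (s'A _ (valP k))) => k; apply: val_inj => /=.
    by rewrite sK.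
  by rewrite s'K.
- exact: val_inj.
move=> k; rewrite /parent /= !ffunE /= Ej (inj_eq s_inj).
case: eqP => //= _; rewrite -!/(parent _ _) s_parent.
case: (parent T (val k)) => //= l.
have lA : (s l \in A') = (l \in A) by rewrite EA mem_imset.
case: (boolP (l \in A)) => [|/negPf] lA'.
  rewrite (insubT (fun x => x \in A') (etrans lA lA')) insubT /=.
  by congr Some; apply: val_inj.
have lA2 : (s l \in A') = false by rewrite lA.
by rewrite (@insubF _ (fun x => x \in A) _ _ lA')
  (@insubF _ (fun x => x \in A') _ _ lA2).
Qed.

Lemma descendants_iso j : descendants T' (s j) = s @: descendants T j.
Proof.
have it m o : iter m (obind (parent T')) (omap s o)
    = omap s (iter m (obind (parent T)) o).
  elim: m o => // m IH o; rewrite !iterSr -IH; congr iter.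
  by case: o => //= k; rewrite s_parent.
case: (s_bij) => s' sK s'K; apply/setP => k; rewrite -(s'K k).
rewrite mem_imset // !inE; apply/asboolP/asboolP => -[m hm]; exists m.
  have := it m (Some (s' k)); rewrite /= hm.
  by case: (iter m (obind (parent T)) _) => //= l [] /s_inj ->.
by have := it m (Some (s' k)); rewrite /= hm.
Qed.

Lemma branch_iso j : unlabel (branch T' (s j)) = unlabel (branch T j).
Proof.
by apply/esym/unlabelP; apply: restrict_iso (descendants_iso j) _.
Qed.

Definition subtree_map (A : subtree T) : subtree T' :=
  exist _ (s @: sval A)
    (etrans (congr1 (restrictable T' _) s_root)
       (restrictable_iso (svalP A))).

End Isomorphism.

Lemma subtree_map_bij (U V : finType) (T : rtree U) (T' : rtree V) (s : U -> V)
    (s_bij : bijective s) (s_root : root T' = s (root T))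
    (s_parent : forall k, parent T' (s k) = omap s (parent T k)) :
  bijective (subtree_map s_bij s_root s_parent).
Proof.
case: (s_bij) => s' sK s'K.
have r' : root T = s' (root T') by rewrite s_root sK.
have p' k : parent T (s' k) = omap s' (parent T' k).
  by rewrite -{2}(s'K k) s_parent; case: parent => //= l; rewrite sK.
have b' : bijective s' by exists s.
exists (subtree_map b' r' p') => A; apply: val_inj => /=;
  by rewrite -imset_comp (eq_imset (g := id)) ?imset_id //= => k /=; rewrite ?sK ?s'K.
Qed.

Lemma subtree_sum_iso (R : realType) (a b : option utree -> R)
    (U V : finType) (T : rtree U) (T' : rtree V) :
  isomorphic T T' -> subtree_sum a b T = subtree_sum a b T'.
Proof.
move=> TT'; case: (TT') => s [sb r p]; apply/esym.
have [h hK h'K] := subtree_map_bij sb r p.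
rewrite /subtree_sum (reindex (omap (subtree_map sb r p))) /=; last first.
  apply: onW_bij; exists (omap h); first by case=> //= A; rewrite hK.
  by case=> //= A; rewrite h'K.
apply: eq_bigr => -[A|] _ /=; last first.
  by congr (_ * forest_weight _ [:: _]); apply/esym/unlabelP.
congr (b (Some _) * _).
  exact/esym/unlabelP/(restrict_iso sb p).
rewrite /forest_weight /= !big_map !big_filter !big_enum_cond /=.
rewrite (reindex s) /=; last exact: onW_bij.
have si := bij_inj sb.
apply: eq_big => [j|j _]; last by rewrite (branch_iso sb p).
rewrite mem_imset // p; congr (_ && _).
case: (parent T j) => [l|] /=; first by rewrite !mem_imset //; move=> ? ? [].
by apply/imsetP/imsetP => -[].
Qed.

Lemma subtree_conv_unlabel (R : realType) (a b : option utree -> R)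
    (U : finType) (T : rtree U) :
  subtree_conv a b (Some (unlabel T)) = subtree_sum a b T.
Proof. exact/subtree_sum_iso/unlabelP/unlabel_repr. Qed.

(* Main.v *)
Require Import Defs.
From mathcomp Require Import all_boot all_order all_algebra.
From mathcomp Require Import boolp reals.

(** On a fixed finite set U, trees and forests are encoded by functions
    q : U -> U that send a vertex to its parent ("flows"). A pair (T, T_0) is the
    same as a vertex set A, a rooted tree on A and a flow of the complement of A
    into A; the latter is a forest whose trees are the elements of T \ T_0,
    each attached to a vertex of A. Let d = f^a(t, g) - g. By induction on k,
    cutting off one tree at a time, the weighted sum over the flows of S into A
    with k trees is |S|!/k! [t^|S|] d^k times the k-th derivative of the product
    over A of the factors of the vertices: choosing the vertex of A to which a
    tree is attached amounts to the Leibniz rule. Summing over A and over the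
    trees on A gives the Taylor expansion of f^b(t, g + d). *)

Set Implicit Arguments.
Unset Strict Implicit.
Unset Printing Implicit Defensive.
(* Re-importing [Defs] makes [root] the root of a tree, not of a polynomial. *)
Import GRing.Theory Num.Theory Defs.
Local Open Scope ring_scope.

(** * Derivatives of power series and sums over subsets *)

Section Derivation.
Context (R : comNzRingType).
Implicit Types f g : fps R.
Local Notation D := (@fps_deriv R).

Lemma fps_scaleAr c f g : c *: (f * g) = f * (c *: g).
Proof. by rewrite mulrC scalerAl mulrC. Qed.

Lemma fps_derivD f g : D (f + g) = D f + D g.
Proof. by apply/fpsP => n /=; rewrite mulrnDl. Qed.

Lemma fps_deriv0 : D 0 = 0.
Proof. by apply/fpsP => n /=; rewrite mul0rn. Qed.

Lemma fps_derivZ c f : D (c *: f) = c *: D f.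
Proof. by apply/fpsP => n /=; rewrite mulrnAr. Qed.

Lemma fps_deriv1 : D 1 = 0.
Proof. by apply/fpsP => n /=; rewrite mul0rn. Qed.

Lemma fps_deriv_sum (I : Type) (r : seq I) (P : pred I) (F : I -> fps R) :
  D (\sum_(i <- r | P i) F i) = \sum_(i <- r | P i) D (F i).
Proof. exact: (big_morph _ fps_derivD fps_deriv0). Qed.

Lemma iter_fps_deriv0 k : iter k D 0 = 0.
Proof. by elim: k => //= k ->; rewrite fps_deriv0. Qed.

Lemma fps_derivM f g : D (f * g) = D f * g + f * D g.
Proof.
apply/fpsP => n /=; rewrite -sumrMnl.
transitivity (\sum_(i < n.+2) (f.[[i]] *+ i * g.[[n.+1 - i]]
    + f.[[i]] * (g.[[n.+1 - i]] *+ (n.+1 - i)))).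
  apply: eq_bigr => i _; rewrite mulrnAl mulrnAr -mulrnDr subnKC //.
  by rewrite -ltnS.
rewrite big_split /=; congr (_ + _).
  by rewrite big_ord_recl mulr0n mul0r add0r.
rewrite big_ord_recr /= subnn mulr0n mulr0 addr0.
by apply: eq_bigr => i _; rewrite subSn // -ltnS.
Qed.


Lemma iter_fps_deriv_sum (I : Type) (r : seq I) (P : pred I) (F : I -> fps R) k :
  iter k D (\sum_(i <- r | P i) F i) = \sum_(i <- r | P i) iter k D (F i).
Proof. by elim: k => //= k ->; rewrite fps_deriv_sum. Qed.

Lemma iter_fps_derivZ c f k : iter k D (c *: f) = c *: iter k D f.
Proof. by elim: k => //= k ->; rewrite fps_derivZ. Qed.

(** Leibniz rule. As [r] has no duplicates, the test [k == l] singles out exactly one factor. *)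
Lemma fps_deriv_prod_seq (I : eqType) (r : seq I) (g : I -> fps R) : uniq r ->
  D (\prod_(l <- r) g l)
  = \sum_(l <- r) \prod_(k <- r) (if k == l then D (g k) else g k).
Proof.
elim: r => [|x r IH] /=; first by rewrite !big_nil fps_deriv1.
case/andP=> xr /IH IHr; rewrite !big_cons fps_derivM IHr eqxx; congr (_ + _).
  congr (_ * _); apply: eq_big_seq => k kr.
  by case: eqP => // kx; rewrite -kx kr in xr.
rewrite mulr_sumr; apply: eq_big_seq => l lr; rewrite big_cons.
by case: eqP => // kx; rewrite kx lr in xr.
Qed.

Lemma fps_deriv_prod (I : finType) (A : {set I}) (g : I -> fps R) :
  D (\prod_(l in A) g l)
  = \sum_(l in A) \prod_(k in A) (if k == l then D (g k) else g k).
Proof.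
rewrite -big_enum fps_deriv_prod_seq ?enum_uniq // big_enum.
by apply: eq_bigr => l _; rewrite big_enum.
Qed.

Lemma sum_subsets_card (M : nmodType) (U : finType) (S : {set U})
    (G : nat -> M) :
  \sum_(D : {set U} | D \subset S) G #|D|
  = \sum_(i < #|S|.+1) G i *+ 'C(#|S|, i).
Proof.
(* [inord] loses nothing here: a subset of [S] has at most [#|S|] elements. *)
rewrite (partition_big (fun D : {set U} => inord #|D| : 'I_#|S|.+1) predT) //=.
apply: eq_bigr => i _; have iS : (i <= #|S|)%N by rewrite -ltnS.
rewrite (eq_bigl (fun D => D \in [set D : {set U} | D \subset S & #|D| == i])).
  rewrite (eq_bigr (fun=> G i)); first by rewrite sumr_const cards_draws.
  by move=> D; rewrite inE => /andP[_ /eqP ->].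
move=> D; rewrite inE; case: (boolP (D \subset S)) => //= /subset_leq_card DS.
by rewrite -val_eqE /= inordK.
Qed.

(** Product rule for exponential generating functions: with [n = #|S|], the ['C(n, i)] subsets of
    size [i] cancel the factorials [i!] and [(n - i)!] against [n!]. *)
Lemma fps_mul_subsets (U : finType) (S : {set U}) (u v : fps (fps R)) :
  \sum_(D : {set U} | D \subset S)
    (#|D|`! * (#|S| - #|D|)`!)%:R *: (u.[[#|D|]] * v.[[#|S| - #|D|]])
  = #|S|`!%:R *: (u * v).[[#|S|]].
Proof.
rewrite (sum_subsets_card _ (fun i =>
  (i`! * (#|S| - i)`!)%:R *: (u.[[i]] * v.[[#|S| - i]]))) scaler_sumr.
apply: eq_bigr => i _; rewrite -(@scaler_nat R) scalerA -natrM bin_fact //.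
by rewrite -ltnS.
Qed.

End Derivation.

(** * Flows and grafting *)

Section Flows.
Context (U : finType).
Implicit Types (A S D : {set U}) (q : {ffun U -> U}).

Lemma fconnectP (f : U -> U) x y :
  reflect (exists m, iter m f x = y) (fconnect f x y).
Proof.
apply: (iffP idP) => [/iter_findex<-|[m <-]]; last exact: fconnect_iter.
by exists (findex f x y).
Qed.

Lemma fconnect_step (f : U -> U) x y :
  fconnect f x y = (x == y) || fconnect f (f x) y.
Proof.
apply/fconnectP/orP => [[[|m]]|[/eqP <-|/fconnectP[m <-]]].
- by move=> <-; left.
- by rewrite iterSr => h; right; apply/fconnectP; exists m.
- by exists 0%N.
- by exists m.+1; rewrite iterSr.
Qed.

Lemma fconnect_fix (f : U -> U) x y : f x = x -> fconnect f x y -> x = y.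
Proof. by move=> fx /fconnectP[m <-]; elim: m => //= m <-. Qed.

(** The orbit of [x] stays in [X], with both maps agreeing along it, until it meets [y]. At [y]
    itself the maps may differ, as they do at the root of a branch that is cut off. *)
Lemma fconnect_agree (X : {set U}) (f f' : U -> U) x y :
  {in X, forall z, z != y -> f z = f' z /\ f z \in X} ->
  x \in X -> fconnect f x y -> fconnect f' x y.
Proof.
move=> ff' + /fconnectP[m]; elim: m x => [|m IH] x xX.
  by move=> /= ->.
rewrite iterSr fconnect_step; have [//|xy] := eqVneq x y.
have [<- fX] := ff' _ xX xy; exact: IH.
Qed.

(** Cut the orbit at its first visit to [X]; before that both maps take the same steps. The vertex
    [z] may differ from [y]. *)
Lemma fconnect_first_hit (X : {set U}) (f f' : U -> U) x y :
  {in ~: X, f =1 f'} -> y \in X -> fconnect f x y ->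
  exists2 z, z \in X & fconnect f' x z.
Proof.
move=> ff' yX /fconnectP[m]; elim: m x => [|m IH] x.
  by move=> /= ->; exists y.
have [xX _|xX] := boolP (x \in X); first by exists x.
rewrite iterSr => /IH[z zX h]; exists z => //.
by rewrite fconnect_step -ff' ?h ?orbT // inE.
Qed.

Lemma fconnect_closed (X : {set U}) (f : U -> U) x y :
  {in X, forall z, f z \in X} -> x \in X -> fconnect f x y -> y \in X.
Proof. by move=> fX xX /fconnectP[m <-]; elim: m => //= m; apply: fX. Qed.

(** A flow is a forest on [A :|: S] whose set of roots is [A]; the function [q]
    maps a vertex of [S] to its parent and is the identity elsewhere. *)
Definition flow A S q :=
  [forall k, if k \in S then [exists l in A, fconnect q k l] else q k == k].

Lemma flowP A S q : reflect
  ({in ~: S, forall k, q k = k} /\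
   {in S, forall k, exists2 l, l \in A & fconnect q k l}) (flow A S q).
Proof.
apply: (iffP forallP) => [h|[h1 h2] k].
  split=> k; last by move=> kS; have := h k; rewrite kS => /exists_inP.
  by rewrite inE => /negPf kS; have := h k; rewrite kS => /eqP.
have [kS|kS] := boolP (k \in S); first exact/exists_inP/h2.
by apply/eqP/h1; rewrite inE.
Qed.

Lemma flow_id A S q k : flow A S q -> k \notin S -> q k = k.
Proof. by case/flowP => h _ kS; apply: h; rewrite inE. Qed.

Lemma flow_connect A S q k : flow A S q -> k \in S ->
  exists2 l, l \in A & fconnect q k l.
Proof. by case/flowP => _; apply. Qed.

(** Every vertex outside [S] is fixed, so an orbit leaving [S] stops at once, and it has to stop in
    [A]. *)
Lemma flow_codom A S q k : [disjoint A & S] -> flow A S q -> k \in S ->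
  q k \in A :|: S.
Proof.
move=> AS fq kS; have [l lA] := flow_connect fq kS; rewrite fconnect_step.
case: eqP => [kl|_ /=]; first by rewrite kl (disjointFr AS) in kS.
rewrite inE; have [|qS] := boolP (q k \in S); first by rewrite orbT.
by move/(fconnect_fix (flow_id fq qS)) ->; rewrite lA.
Qed.

(** Being the identity outside [S] makes a flow determined by its values on [S], so that a sum over
    flows counts every forest once. *)
Definition frst S q : {ffun U -> U} := [ffun k => if k \in S then q k else k].

(** The roots of the trees that remain when [A] is removed, that is, of the difference forest. *)
Definition cuts A S q : {set U} := [set j in S | q j \in A].

Definition above q j : {set U} := [set k | fconnect q k j].

(** Only vertices of [S] count as children, so that a fixed point such as the root is not its own
    child. *)
Definition indeg S q l : nat := #|[set k in S | q k == l]|.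

Lemma above_flow A S q j : flow A S q -> j \in S -> above q j \subset S.
Proof.
move=> fq jS; apply/subsetP => k; rewrite inE => h.
by apply: contraLR jS => kS; rewrite -(fconnect_fix (flow_id fq kS) h).
Qed.

(* The flow obtained from [q1] and the tree [q2] on [D] with root [j] when [j]
   is attached to [l]. *)
Definition graft D j l (q : {ffun U -> U} * {ffun U -> U}) : {ffun U -> U} :=
  [ffun k => if k == j then l else if k \in D then q.2 k else q.1 k].

(** In the second component [j] becomes a fixed point; the vertex it was attached to is [q j], which
    [graft] takes as the argument [l]. *)
Definition ungraft S D j q : {ffun U -> U} * {ffun U -> U} :=
  (frst (S :\: D) q, frst (D :\ j) q).

(** * Cutting off one tree and attaching it again *)

Section Graft.
Context (A S D : {set U}) (j l : U) (AS : [disjoint A & S]).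
Context (DS : D \subset S) (jD : j \in D) (lA : l \in A).

Let jS : j \in S := subsetP DS _ jD.
Let lS : l \notin S. Proof. by rewrite (disjointFr AS). Qed.
Let lD : l \notin D. Proof. exact: contra (subsetP DS l) lS. Qed.
Let ASD : [disjoint A & S :\: D].
Proof. by apply: disjointWr AS; apply: subsetDl. Qed.
Let jDj : [disjoint [set j] & D :\ j].
Proof. by rewrite disjoints1 !inE eqxx. Qed.

(** [D] consists of all vertices whose orbit meets [j]. Hence the complement of [D] is stable under
    [q], and orbits starting in [D] stay in [D] up to [j], so both pieces remain connected to their
    roots. *)
Lemma ungraft_flow q : flow A S q -> q j = l -> above q j = D ->
  [/\ flow A (S :\: D) (ungraft S D j q).1,
      flow [set j] (D :\ j) (ungraft S D j q).2 &
      graft D j l (ungraft S D j q) = q].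
Proof.
move=> fq qj aD; have inD k : (k \in D) = fconnect q k j by rewrite -aD inE.
split.
- apply/flowP; split=> k; first by rewrite inE ffunE => /negPf ->.
  move=> kSD; have /setDP[kS kD] := kSD; have [m mA km] := flow_connect fq kS.
  exists m => //; apply: (fconnect_agree (X := ~: D)) km; last by rewrite inE.
  move=> z; rewrite inE => zD _; rewrite ffunE inE zD /=; split.
    by case: ifPn => // /(flow_id fq).
  rewrite inE; apply: contra zD; rewrite !inD => h.
  by rewrite fconnect_step h orbT.
- apply/flowP; split=> k; first by rewrite inE ffunE => /negPf ->.
  case/setD1P=> kj kD; exists j; first by rewrite inE.
  have := kD; rewrite inD; apply: (fconnect_agree (X := D)) => // z zD zj.
  rewrite ffunE !inE zj zD; split=> //; move: zD.
  by rewrite !inD fconnect_step (negPf zj).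
apply/ffunP => k; rewrite ffunE; have [->//|kj] := eqVneq k j.
rewrite /= !ffunE !inE kj /=; have [//|kD] := boolP (k \in D).
by case: ifPn => // /(flow_id fq).
Qed.

Section Pieces.
Context (q1 q2 : {ffun U -> U}).
Context (f1 : flow A (S :\: D) q1) (f2 : flow [set j] (D :\ j) q2).
Local Notation q := (graft D j l (q1, q2)).

Lemma graft_root : q j = l. Proof. by rewrite ffunE eqxx. Qed.

Lemma graft_in k : k \in D -> k != j -> q k = q2 k /\ q2 k \in D.
Proof.
move=> kD kj; rewrite ffunE (negPf kj) kD; split=> //.
have /(flow_codom jDj f2) : k \in D :\ j by rewrite !inE kj.
by rewrite !inE; have [->//|] := eqVneq (q2 k) j.
Qed.

Lemma graft_out k : k \notin D -> q k = q1 k /\ q1 k \notin D.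
Proof.
move=> kD; rewrite ffunE (negPf kD) ifN; last by apply: contraNneq kD => ->.
split=> //; have [kSD|kSD] := boolP (k \in S :\: D); last first.
  by rewrite (flow_id f1 kSD).
have /setUP[|/setDP[]//] := flow_codom ASD f1 kSD.
by move=> h; apply/negP => /(subsetP DS); rewrite (disjointFr AS).
Qed.

Let outq : {in ~: D, forall z, q z \in ~: D}.
Proof. by move=> z; rewrite !inE => /graft_out[->]. Qed.

Lemma above_graft : above q j = D.
Proof.
apply/setP => k; rewrite inE; have [kD|kD] := boolP (k \in D).
  have [->|kj] := eqVneq k j; first exact: connect0.
  have /(flow_connect f2) : k \in D :\ j by rewrite !inE kj.
  case=> j'; rewrite inE => /eqP-> kj2.
  apply: (fconnect_agree (X := D)) kj2 => // z zD.
  by move=> /(graft_in zD)[-> ->].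
apply/negP => kj; have := fconnect_closed outq _ kj.
by rewrite !inE kD jD => /(_ isT).
Qed.

(** The new branch hangs from [l], which lies outside [S], so it adds nothing to the other
    branches. *)
Lemma above_graft_out k : k \in S :\: D -> above q k = above q1 k.
Proof.
case/setDP=> kS kD; apply/setP => m; rewrite !inE.
have [mD|mD] := boolP (m \in D).
  apply/idP/idP => h; last first.
    have m1 : q1 m = m by apply: flow_id f1 _; rewrite inE mD.
    by have := fconnect_fix m1 h => mk; rewrite -mk mD in kD.
  (* The set [l |: D] is closed under the grafted flow, as [l] is fixed; yet [k] lies outside it. *)
  suff : k \in l |: D.
    by rewrite !inE (negPf kD) orbF => /eqP kl; move: lS; rewrite -kl kS.
  apply: fconnect_closed h; last by rewrite !inE mD orbT.
  move=> z; rewrite !inE => /predU1P[->|zD].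
    have [-> _] := graft_out lD.
    by rewrite (flow_id f1) ?eqxx // !inE lD (negPf lS).
  have [->|zj] := eqVneq z j; first by rewrite graft_root eqxx.
  by have [-> ->] := graft_in zD zj; rewrite orbT.
have mD' : m \in ~: D by rewrite inE.
by apply/idP/idP; apply: (fconnect_agree (X := ~: D)) => // z; rewrite inE => zD _;
  have [-> h] := graft_out zD; rewrite inE.
Qed.

Lemma graft_flow : flow A S q.
Proof.
apply/flowP; split=> k.
  rewrite inE => kS; have kD : k \notin D by apply: contra kS; apply: subsetP.
  by have [-> _] := graft_out kD; rewrite (flow_id f1) // !inE (negPf kS) andbF.
move=> kS; have [kD|kD] := boolP (k \in D).
  exists l => //; have : k \in above q j by rewrite above_graft.
  by rewrite inE => /connect_trans; apply; have := fconnect1 q j; rewrite graft_root.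
have /(flow_connect f1)[m mA km] : k \in S :\: D by rewrite inE kD.
exists m => //; apply: (fconnect_agree (X := ~: D)) km; last by rewrite inE.
by move=> z; rewrite inE => zD _; have [-> h] := graft_out zD; rewrite inE.
Qed.

Lemma graftK : ungraft S D j q = (q1, q2).
Proof.
congr (_, _); apply/ffunP => k; rewrite ffunE !inE.
  have [kD|kD] /= := boolP (k \in D).
    by rewrite (flow_id f1) // !inE kD.
  have [-> _] := graft_out kD.
  by case: ifPn => // kS; rewrite (flow_id f1) // !inE (negPf kS) andbF.
have [->|kj] /= := eqVneq k j.
  by rewrite (flow_id f2) // !inE eqxx.
case: ifPn => [kD|kD]; first by have [-> _] := graft_in kD kj.
by rewrite (flow_id f2) // !inE kj.
Qed.

Lemma cuts_graft : cuts A S q = j |: cuts A (S :\: D) q1.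
Proof.
apply/setP => k; rewrite !inE.
have [->|kj] /= := eqVneq k j; first by rewrite graft_root lA jS.
have [kD|kD] /= := boolP (k \in D).
  have [-> /(subsetP DS) qS] := graft_in kD kj.
  by rewrite (disjointFl AS) ?andbF.
by have [-> _] := graft_out kD.
Qed.

Lemma indeg_graft_in k : k \in D ->
  indeg S q k = indeg (D :\ j) q2 k.
Proof.
move=> kD; apply: eq_card => m; rewrite !inE.
have [->|mj] /= := eqVneq m j.
  by rewrite graft_root; case: eqP => [lk|];
    [rewrite -lk (negPf lD) in kD | rewrite andbF].
have [mD|mD] /= := boolP (m \in D).
  by have [-> _] := graft_in mD mj; rewrite (subsetP DS).
by have [-> h] := graft_out mD; case: eqP h => [->|]; rewrite ?kD ?andbF.
Qed.

(** The summand [k == l] is the new child [j] of [l]; it becomes the extra derivative in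
    [derive_at]. *)
Lemma indeg_graft_out k : k \notin D ->
  indeg S q k = (indeg (S :\: D) q1 k + (k == l))%N.
Proof.
move=> kD; rewrite /indeg (cardsD1 j) !inE jS graft_root eq_sym addnC.
congr (_ + _)%N; apply: eq_card => m; rewrite !inE.
have [->|mj] /= := eqVneq m j; first by rewrite jD.
have [mD|mD] /= := boolP (m \in D).
  have [-> h] := graft_in mD mj.
  by case: eqP h => [->|]; rewrite ?(negPf kD) ?andbF.
by have [-> _] := graft_out mD.
Qed.

End Pieces.
End Graft.
End Flows.

(** * A tree as a subtree and a flow into it *)

Section Overlay.
Context (U : finType).
Implicit Types (A : {set U}) (q : {ffun U -> U}).

(** Orbits of [f] cannot leave [A], so one that ends outside [A] never visits it and only meets
    vertices where the two maps agree. *)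
Lemma fconnect_avoid A (f f' : U -> U) x y :
  {in ~: A, f =1 f'} -> {in A, forall z, f z \in A} -> y \notin A ->
  fconnect f x y -> fconnect f' x y.
Proof.
move=> ff' fA yA /fconnectP[m]; elim: m x => [|m IH] x.
  by move=> /= ->.
have [xA xy|xA] := boolP (x \in A).
  have := fconnect_closed fA xA (_ : fconnect f x y).
  by rewrite (negPf yA) => h; case: notF; apply: h; apply/fconnectP; exists m.+1.
by rewrite iterSr fconnect_step => /IH h; rewrite -ff' ?h ?orbT // inE.
Qed.

Definition overlay A (q : {ffun U -> U} * {ffun U -> U}) : {ffun U -> U} :=
  [ffun k => if k \in A then q.1 k else q.2 k].

Definition unoverlay A r q := (frst (A :\ r) q, frst (~: A) q).

Context (A : {set U}) (r : U) (rA : r \in A).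

(** Here [q] is a tree on all of [U] with root [r], and stability of [A] says that [A] is a rooted
    subtree. Orbits from [A] reach [r] inside [A]; orbits from outside enter [A] at some point,
    because [r] lies in [A]. *)
Lemma unoverlay_flow q : flow [set r] (~: [set r]) q ->
    {in A, forall k, q k \in A} ->
  [/\ flow [set r] (A :\ r) (unoverlay A r q).1,
      flow A (~: A) (unoverlay A r q).2 & overlay A (unoverlay A r q) = q].
Proof.
move=> fq qA; have qr : q r = r by apply: flow_id fq _; rewrite !inE eqxx.
have conn k : fconnect q k r.
  have [->|kr] := eqVneq k r; first exact: connect0.
  have /(flow_connect fq)[r'] : k \in ~: [set r] by rewrite !inE.
  by rewrite inE => /eqP ->.
split.
- apply/flowP; split=> k; first by rewrite inE ffunE => /negPf ->.
  case/setD1P=> kr kA; exists r; first by rewrite inE.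
  apply: (fconnect_agree (X := A)) (conn k) => // z zA zr.
  by rewrite ffunE !inE zr zA /= qA.
- apply/flowP; split=> k; first by rewrite inE ffunE => /negPf ->.
  move=> _; apply: fconnect_first_hit rA (conn k) => z zA.
  by rewrite ffunE zA.
apply/ffunP => k; rewrite ffunE /= !ffunE !inE.
by have [->|] := eqVneq k r; case: (k \in A) => //=; rewrite ?qr ?if_same.
Qed.

Section Pieces.
Context (q0 q1 : {ffun U -> U}).
Context (f0 : flow [set r] (A :\ r) q0) (f1 : flow A (~: A) q1).
Local Notation q := (overlay A (q0, q1)).

Let rAr : [disjoint [set r] & A :\ r].
Proof. by rewrite disjoints1 !inE eqxx. Qed.

Lemma overlay_in k : k \in A -> q k = q0 k /\ q0 k \in A.
Proof.
move=> kA; rewrite ffunE kA; split=> //.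
have [->|kr] := eqVneq k r; first by rewrite (flow_id f0) // !inE eqxx.
have /(flow_codom rAr f0) : k \in A :\ r by rewrite !inE kr.
by rewrite !inE; have [->|] := eqVneq (q0 k) r.
Qed.

Lemma overlay_out k : k \notin A -> q k = q1 k.
Proof. by rewrite ffunE => /negPf ->. Qed.

Lemma overlay_closed : {in A, forall k, q k \in A}.
Proof. by move=> k /overlay_in[->]. Qed.

Lemma overlay_flow : flow [set r] (~: [set r]) q.
Proof.
have qr : q r = r.
  by have [-> _] := overlay_in rA; rewrite (flow_id f0) // !inE eqxx.
have conn k : k \in A -> fconnect q k r.
  have [->|kr] := eqVneq k r; first by rewrite connect0.
  move=> kA; have /(flow_connect f0)[r'] : k \in A :\ r by rewrite !inE kr.
  rewrite inE => /eqP ->; apply: (fconnect_agree (X := A)) => // z zA _.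
  by have [-> ->] := overlay_in zA.
apply/flowP; split=> k; first by rewrite !inE negbK => /eqP ->.
move=> _; exists r; first by rewrite inE.
have [kA|kA] := boolP (k \in A); first exact: conn.
have /(flow_connect f1)[l lA kl] : k \in ~: A by rewrite inE.
have [] := fconnect_first_hit (f' := q) _ lA kl.
  by move=> z; rewrite inE => /overlay_out.
by move=> m mA km; apply: connect_trans km (conn _ mA).
Qed.

Lemma overlayK : unoverlay A r q = (q0, q1).
Proof.
congr (_, _); apply/ffunP => k; rewrite ffunE !inE.
  have [->|kr] /= := eqVneq k r; first by rewrite (flow_id f0) // !inE eqxx.
  case: ifPn => [kA|kA]; first by have [->] := overlay_in kA.
  by rewrite (flow_id f0) // !inE negb_and kA orbT.
have [kA|kA] /= := boolP (k \in A); last exact: overlay_out.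
by rewrite (flow_id f1) // inE kA.
Qed.

Lemma cuts_overlay : cuts A (~: A) q = cuts A (~: A) q1.
Proof.
apply/setP => k; rewrite !inE; have [//|kA] /= := boolP (k \in A).
by rewrite overlay_out.
Qed.

Lemma above_overlay k : k \notin A -> above q k = above q1 k.
Proof.
move=> kA; apply/setP => m; rewrite !inE.
apply/idP/idP; apply: fconnect_avoid (kA) => z; rewrite ?inE.
- exact: overlay_out.
- exact: overlay_closed.
- by move/overlay_out.
- by move=> zA; rewrite (flow_id f1) // inE zA.
Qed.

Lemma indeg_overlay k : indeg (~: [set r]) q k =
  (indeg (A :\ r) q0 k + indeg (~: A) q1 k)%N.
Proof.
rewrite /indeg -(cardsID A); congr (_ + _)%N; apply: eq_card => m; rewrite !inE.
  have [->|mr] /= := eqVneq m r; first by [].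
  have [mA|mA] /= := boolP (m \in A); last by rewrite andbF.
  by have [->] := overlay_in mA; rewrite andbT.
have [mA|mA] /= := boolP (m \in A); first by [].
rewrite overlay_out //; suff -> : m != r by [].
by apply: contraNneq mA => ->.
Qed.

End Pieces.
End Overlay.

(** * Rooted trees as flows *)

Section RootedTrees.
Context (V : finType).
Implicit Types (T : rtree V).

(** Making the root a fixed point turns the partial parent map into a total one, to which [fconnect]
    applies. *)
Definition par T (k : V) : V := odflt k (parent T k).

Lemma parent_eq_None T k : (parent T k == None) = (k == root T).
Proof. by case/andP: (rtreeP T) => /forallP/(_ k)/eqP. Qed.

Lemma parentE T k : parent T k = if k == root T then None else Some (par T k).
Proof.
rewrite -parent_eq_None /par.
by case: (parent T k).
Qed.

Lemma par_root T : par T (root T) = root T.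
Proof. by rewrite /par parentE eqxx. Qed.

(** The vertices that never reach the root form a set closed under parents and avoiding the root;
    the tree axiom forces it to be empty. *)
Lemma par_connect T k : fconnect (par T) k (root T).
Proof.
have /andP[_ /forallP acyc] := rtreeP T; apply: contraT => kr.
pose S := [set k | ~~ fconnect (par T) k (root T)].
suff /(implyP (acyc S))/negP[] : (S != set0) && (root T \notin S); last first.
  by rewrite inE connect0 andbT; apply/set0Pn; exists k; rewrite inE.
apply/subsetP => _ /imsetP[z zr ->]; rewrite -/(parent T z) parentE.
rewrite inE fconnect_step negb_or in zr; case/andP: zr => /negPf -> zr.
by apply: imset_f; rewrite inE.
Qed.

Lemma rtree_eq T T' : root T = root T' -> par T =1 par T' -> T = T'.
Proof.
move=> rr pp; apply: val_inj => /=.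
rewrite (surjective_pairing (rtree_val T)) (surjective_pairing (rtree_val T')).
congr (_, _) => //; apply/ffunP => k.
by rewrite -!/(parent _ k) !parentE rr pp.
Qed.

Lemma descendants_above T j : descendants T j = above [ffun k => par T k] j.
Proof.
have none i : iter i (obind (parent T)) None = None by elim: i => //= i ->.
apply/setP => k; rewrite !inE; apply/asboolP/fconnectP => -[m].
  elim: m k => [|m IH] k; first by case=> <-; exists 0%N.
  rewrite iterSr /= parentE; case: ifP => _; first by rewrite none.
  by case/IH => i <-; exists i.+1; rewrite iterSr ffunE.
elim: m k => [|m IH] k; first by move=> /= <-; exists 0%N.
(* At the root [par] idles, whereas iterating [parent] would fall to [None]; idle steps are dropped,
   so the number of steps may shrink. *)
rewrite iterSr ffunE; have [->|kr] := eqVneq k (root T).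
  by rewrite par_root; apply: IH.
by case/IH => i h; exists i.+1; rewrite iterSr /= parentE (negPf kr).
Qed.

End RootedTrees.

(** * Isomorphism classes of trees given by parent functions *)

Section Realizations.
Context (U : finType).
Implicit Types (D : {set U}) (j : U) (q : {ffun U -> U}).

(** The labeled tree [T] is, up to the injection [s], the rooted tree on [D]
    with root [j] and parent function [q]. *)
Definition realizes (V : finType) (s : V -> U) (T : rtree V) D j q : Prop :=
  [/\ injective s, D = s @: setT, s (root T) = j &
      forall v, v != root T -> s (par T v) = q (s v)].

(** Both injections have image [D], so [s] followed by the inverse of [s'] is a bijection; it
    respects roots and parents because both trees mirror [j] and [q]. *)
Lemma realizes_iso (V V' : finType) (s : V -> U) (s' : V' -> U)
    (T : rtree V) (T' : rtree V') D j q :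
  realizes s T D j q -> realizes s' T' D j q -> isomorphic T T'.
Proof.
case=> si Ds rj sq [s'i Ds' r'j s'q].
have surj (W W' : finType) (t : W -> U) (t' : W' -> U) (x : W') w :
    t @: setT = t' @: setT -> t' (odflt x [pick w' | t' w' == t w]) = t w.
  move=> tt'; case: pickP => [w' /eqP //|no].
  have : t w \in t' @: setT by rewrite -tt' imset_f.
  by case/imsetP => w' _ tw; have := no w'; rewrite tw eqxx.
(* The default values only make [f] and [g] total: since the images coincide, [pick] always
   succeeds. *)
pose f v := odflt (root T') [pick v' | s' v' == s v].
pose g v' := odflt (root T) [pick v | s v == s' v'].
have fE v : s' (f v) = s v by apply: surj; rewrite -Ds.
have gE v : s (g v) = s' v by apply: surj; rewrite -Ds.
have fr : f (root T) = root T' by apply: s'i; rewrite fE rj.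
exists f; split.
- by exists g => v; [apply: si|apply: s'i]; rewrite ?gE ?fE ?gE.
- by [].
move=> k; rewrite !parentE -fr (inj_eq (_ : injective f)); last first.
  by move=> x y xy; apply: si; rewrite -!fE xy.
case: eqVneq => //= kr; congr Some; apply: s'i.
rewrite s'q ?fE ?sq //; apply: contraNneq kr => fk.
by apply/eqP/si; rewrite -fE fk r'j.
Qed.

Definition tree_class D j q (t : utree) : Prop :=
  exists (V : finType) (s : V -> U) (T : rtree V),
    realizes s T D j q /\ t = unlabel T.

(** Choosing the class from any realization makes this total in [q]; [realizes_iso] makes the choice
    harmless. The value is [None] when [q] does not describe a tree on [D]. *)
Definition class_of D j q : option utree :=
  if pselect (exists t, tree_class D j q t) is left e
  then Some (projT1 (cid e)) else None.

Lemma class_of_realizes (V : finType) (s : V -> U) (T : rtree V) D j q :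
  realizes s T D j q -> class_of D j q = Some (unlabel T).
Proof.
move=> sT; rewrite /class_of; case: pselect => [e|[]]; last first.
  by exists (unlabel T), V, s, T.
case: (cid e) => /= t [V' [s' [T' [sT' ->]]]]; congr Some.
exact/unlabelP/(realizes_iso sT' sT).
Qed.

Lemma eq_realizes (V : finType) (s : V -> U) (T : rtree V) D j q q' :
  {in D :\ j, q =1 q'} -> realizes s T D j q -> realizes s T D j q'.
Proof.
move=> qq' [si Ds rj sq]; split=> // v vr; rewrite sq // qq' //.
by rewrite !inE -rj (inj_eq si) vr Ds imset_f.
Qed.

(** Leaving out [j] lets a branch keep its class whether its root is attached to a vertex or has
    become a fixed point after cutting. *)
Lemma eq_class_of D j q q' :
  {in D :\ j, q =1 q'} -> class_of D j q = class_of D j q'.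
Proof.
move=> qq'; rewrite /class_of.
suff -> : tree_class D j q = tree_class D j q' by [].
apply/funext => t; apply/propext.
by split=> -[V [s [T [sT tT]]]]; exists V, s, T; split=> //;
  apply: eq_realizes sT => k kD; rewrite qq'.
Qed.

Lemma restrict_realizes (T : rtree U) A j (h : restrictable T A j) :
  realizes val (restrict h) A j [ffun k => par T k].
Proof.
split=> //; first exact: val_inj.
  apply/setP => k; apply/idP/imsetP => [kA|[[l lA] _ ->]//].
  by exists (Sub k kA).
move=> -[k kA]; rewrite -val_eqE /= => kj; rewrite ffunE.
rewrite {1}/par /parent /= ffunE /= (negPf kj) -/(parent T k).
have /andP[_ /subsetP/(_ (parent T k))] := h.
rewrite imset_f ?inE ?kj // => /(_ isT)/imsetP[l lA pk].
by rewrite /par pk /= insubT.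
Qed.

(** * Transport of labeled trees along an injection *)

Section Carry.
Context (V : finType) (s : V -> U) (si : injective s).

Definition carry (T : rtree V) : {ffun U -> U} :=
  [ffun u => if [pick v | s v == u] is Some v then s (par T v) else u].

Lemma carryE T v : carry T (s v) = s (par T v).
Proof.
rewrite ffunE; case: pickP => [w /eqP/si->//|/(_ v)].
by rewrite eqxx.
Qed.

Lemma carry_realizes T : realizes s T (s @: setT) (s (root T)) (carry T).
Proof. by split=> // v _; rewrite carryE. Qed.

Lemma carry_flow T :
  flow [set s (root T)] ((s @: setT) :\ s (root T)) (carry T).
Proof.
apply/flowP; split=> k; rewrite !inE => h.
  have [/imsetP[v _ kv]|no] := boolP (k \in s @: setT); last first.
    rewrite ffunE; case: pickP => // v /eqP vk.
    by rewrite -vk imset_f in no.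
  move: h; rewrite kv imset_f // andbT negbK carryE => /eqP/si->.
  by rewrite par_root.
case/andP: h => _ /imsetP[v _ ->]; exists (s (root T)); first by rewrite inE.
have /fconnectP[m <-] := par_connect T v; apply/fconnectP; exists m.
by elim: m => //= m ->; rewrite carryE.
Qed.

(** The tree is [q] pulled back along [s], with the parent of the root erased; acyclicity follows
    from every orbit of [q] reaching the root. *)
Lemma flow_tree j q : j \in s @: setT ->
    flow [set j] ((s @: setT) :\ j) q ->
  exists T : rtree V, s (root T) = j /\ carry T = q.
Proof.
case/imsetP=> r _ ->{j} fq.
have cd v : v != r -> exists w, s w = q (s v).
  move=> vr; have : q (s v) \in [set s r] :|: (s @: setT) :\ s r.
    apply: flow_codom fq _; first by rewrite disjoints1 !inE eqxx.
    by rewrite !inE (inj_eq si) vr imset_f.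
  rewrite !inE; have [->|_ /= /imsetP[w _ ->]] := eqVneq (q (s v)) (s r).
    by exists r.
  by exists w.
pose p : {ffun V -> option V} :=
  [ffun v => if v == r then None else [pick w | s w == q (s v)]].
have pE v : v != r -> exists2 w, p v = Some w & s w = q (s v).
  move=> vr; have [w sw] := cd _ vr; exists w => //; rewrite ffunE (negPf vr).
  by case: pickP => [w'|/(_ w)]; rewrite -sw ?(inj_eq si) => /eqP // ->.
have ax : rtree_axiom (r, p).
  apply/andP; split; apply/forallP => /=.
    by move=> v; have [->|/[dup] vr /pE[w ->]] := eqVneq v r; rewrite ?ffunE ?eqxx.
  move=> S; apply/implyP => /andP[/set0Pn[v vS] rS]; apply/negP => /subsetP cl.
  have Sr w : w \in S -> w != r by move=> wS; apply: contraNneq rS => <-.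
  have /(flow_connect fq)[j] : s v \in (s @: setT) :\ s r.
    by rewrite !inE (inj_eq si) Sr // imset_f.
  rewrite inE => /eqP -> vr; move/negP: rS; apply.
  (* [s @: S] is stable under [q], so the orbit of [s v] would end inside it and put [r] into
     [S]. *)
  rewrite -(mem_imset _ _ si).
  apply: fconnect_closed vr; last exact: imset_f.
  move=> _ /imsetP[w wS ->]; have [w' pw <-] := pE _ (Sr _ wS).
  have /cl/imsetP[w'' w''S] : p w \in p @: S by apply: imset_f.
  by rewrite pw => -[->]; apply: imset_f.
exists (RTree ax); split=> //; apply/ffunP => u; rewrite ffunE.
case: pickP => [v /eqP <-|no].
  have [->|vr] := eqVneq v r; last first.
    by rewrite /par /parent /=; have [w ->] := pE _ vr.
  by rewrite (par_root (RTree ax)) (flow_id fq) // !inE eqxx.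
rewrite (flow_id fq) // !inE negb_and orbC.
by apply/orP; left; apply/imsetP => -[v _ uv]; have := no v; rewrite uv eqxx.
Qed.

Lemma carry_inj T T' :
  s (root T) = s (root T') -> carry T = carry T' -> T = T'.
Proof.
move=> /si rr cc; apply: rtree_eq => // v; apply: si.
by rewrite -!carryE cc.
Qed.

(** Sending [T] to its carried root and parent function is injective by [carry_inj] and reaches
    every flow by [flow_tree]. *)
Lemma sum_carry (M : nmodType) (F : U -> {ffun U -> U} -> M) :
  \sum_(T : rtree V) F (s (root T)) (carry T) =
  \sum_(j in s @: setT) \sum_(q | flow [set j] ((s @: setT) :\ j) q) F j q.
Proof.
pose h T := (s (root T), carry T).
have hi : injective h by move=> T T' [/carry_inj]; apply.
rewrite pair_big_dep /=.
transitivity (\sum_(T in [set: rtree V]) F (h T).1 (h T).2).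
  by apply: eq_bigl => T; rewrite inE.
rewrite -(big_imset (h := h) (A := setT) (fun x => F x.1 x.2)) /=; last first.
  by move=> T T' _ _; apply: hi.
apply: eq_bigl => -[j q] /=; apply/imsetP/andP => [[T _ [-> ->]]|[jD fq]].
  by split; [apply: imset_f|apply: carry_flow].
by have [T [Tj Tq]] := flow_tree jD fq; exists T; rewrite // /h Tj Tq.
Qed.

End Carry.
End Realizations.

(** * Weighted sums of forests *)

Section ForestSums.
Context (R : realType) (beta : fps R) (U : finType).
Implicit Types (A S D : {set U}) (q : {ffun U -> U}) (g : U -> fps R).
Implicit Types (c : option utree -> R).

Local Notation deriv := (@fps_deriv R).

(** The factors [g l] depend on the vertex because some derivatives are already taken: those due to
    a branch that was cut off, or to the children inside a subtree. *)
Definition vertex_prod S A g q : fps R :=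
  \prod_(l in A) iter (indeg S q l) deriv (g l).

Definition labeled_sum c D : fps R :=
  \sum_(j in D) \sum_(q | flow [set j] (D :\ j) q)
    c (class_of D j q) *: vertex_prod (D :\ j) D (fun=> beta) q.

Lemma tree_term_carry (V : finType) (s : V -> U) (si : injective s) T :
  tree_term beta T = vertex_prod (s @: setT :\ s (root T)) (s @: setT)
    (fun=> beta) (carry s T).
Proof.
rewrite /vertex_prod big_imset /=; last by move=> ? ? _ _; apply: si.
rewrite /tree_term big_mkcond /= [RHS]big_mkcond /=.
apply: eq_bigr => l _; rewrite inE; congr (iter _ _ _).
rewrite /degree /indeg -(card_imset _ si).
apply: eq_card => u; rewrite !inE.
apply/imsetP/andP => [[k + ->]|[/andP[+ /imsetP[k _ uk]]]].
  rewrite inE parentE; have [//|kr] := eqVneq k (root T); move=> /eqP[<-].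
  by rewrite carryE // eqxx (inj_eq si) kr imset_f.
rewrite uk (inj_eq si) carryE // => kr.
by rewrite (inj_eq si) => /eqP kl; exists k; rewrite // inE parentE (negPf kr) kl.
Qed.

Lemma labeled_sum_imset c (V : finType) (s : V -> U) (si : injective s) :
  labeled_sum c (s @: setT) =
  \sum_(T : rtree V) c (Some (unlabel T)) *: tree_term beta T.
Proof.
rewrite /labeled_sum -(sum_carry si (fun j q =>
  c (class_of (s @: setT) j q) *:
  vertex_prod (s @: setT :\ j) (s @: setT) (fun=> beta) q)).
apply: eq_bigr => T _; rewrite (class_of_realizes (carry_realizes si T)).
by rewrite -tree_term_carry.
Qed.

(** Enumerating [D] turns its flows into the trees on ['I_#|D|]. The empty set is set apart: it
    carries no tree, while the constant coefficient of the series is [c None *: fpsX]. *)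
Lemma labeled_sum_series c D : D != set0 ->
  labeled_sum c D = #|D|`!%:R *: (tree_series beta c).[[#|D|]].
Proof.
pose s := @enum_val U (mem D); have si : injective s := @enum_val_inj _ _.
have DE : s @: setT = D.
  apply/setP => k; apply/imsetP/idP => [[i _ ->]|kD]; first exact: enum_valP.
  by exists (enum_rank_in kD k); rewrite // /s enum_rankK_in.
rewrite -card_gt0 => D0; have := labeled_sum_imset c si; rewrite DE => ->.
rewrite /= gtn_eqF // scalerA divff ?scale1r // pnatr_eq0.
by rewrite -lt0n fact_gt0.
Qed.

Lemma labeled_sum0 c : labeled_sum c set0 = 0.
Proof. by rewrite /labeled_sum big_set0. Qed.

Context (a : option utree -> R).

Definition forest_class_weight A S q : R :=
  \prod_(j in cuts A S q) a (class_of (above q j) j q).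

Definition forest_term A S g q : fps R :=
  forest_class_weight A S q *: vertex_prod S (A :|: S) g q.

Definition forest_sum k A S g : fps R :=
  \sum_(q | flow A S q && (#|cuts A S q| == k)) forest_term A S g q.

Definition derive_at l g : U -> fps R :=
  fun k => if k == l then deriv (g k) else g k.

Section Step.
Context (A S : {set U}) (AS : [disjoint A & S]) (g : U -> fps R).
Context (gbeta : forall l, l \notin A -> g l = beta).

(** The tree on [D] contributes its class as one new factor and leaves the other branches unchanged.
    Its own vertices all have factor [beta], since [D] is disjoint from [A]; outside [D] only [l]
    gains a child. *)
Lemma forest_term_graft D j l q1 q2 :
  D \subset S -> j \in D -> l \in A ->
  flow A (S :\: D) q1 -> flow [set j] (D :\ j) q2 ->
  forest_term A S g (graft D j l (q1, q2)) =
  forest_term A (S :\: D) (derive_at l g) q1 *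
  (a (class_of D j q2) *: vertex_prod (D :\ j) D (fun=> beta) q2).
Proof.
move=> DS jD lA f1 f2; rewrite -fps_scaleAr -scalerAl scalerA.
congr (_ *: _).
  rewrite /forest_class_weight cuts_graft // big_setU1 /=; last first.
    by rewrite !inE jD.
  rewrite (above_graft l AS DS jD f1 f2); congr (a _ * _).
    apply: eq_class_of => z /setD1P[zj zD].
    by have [->] := graft_in l jD q1 f2 zD zj.
  apply: eq_bigr => k; rewrite inE => /andP[kSD _].
  rewrite (above_graft_out AS DS jD lA f1 f2 kSD); congr (a _).
  apply: eq_class_of => z /setD1P[_ /(subsetP (above_flow f1 kSD))].
  by case/setDP=> _ zD; have [->] := graft_out l AS DS jD q2 f1 zD.
rewrite /vertex_prod (big_setID D) /= mulrC; congr (_ * _).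
  apply: eq_big => k; rewrite !inE.
    have [kD|] := boolP (k \in D); rewrite ?andbF //= orbF.
    by rewrite (disjointFl AS) // (subsetP DS).
  case/andP=> kD _; rewrite (indeg_graft_out l AS DS jD f1 f2) // /derive_at.
  (* By [iterSr] the additional derivative at [l] is taken first, directly on [g l]. *)
  by case: eqP => _; rewrite ?addn1 ?addn0 // iterSr.
apply: eq_big => k; rewrite !inE.
  have [kD|] := boolP (k \in D); rewrite ?andbF //=.
  by rewrite (subsetP DS) ?orbT.
case/andP=> _ kD; rewrite (indeg_graft_in AS DS jD lA f1 f2) // gbeta //.
by rewrite (disjointFl AS) // (subsetP DS).
Qed.

(** For a fixed branch [D] with root [j] attached to [l], [graft] and [ungraft] identify the forests
    with pairs of independent flows, and [forest_term_graft] makes the sum a product. *)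
Lemma forest_sum_fiber k D j l : D \subset S -> j \in D -> l \in A ->
  \sum_(q | [&& flow A S q && (#|cuts A S q| == k.+1), j \in cuts A S q
             & (above q j, q j) == (D, l)]) forest_term A S g q
  = (\sum_(q | flow [set j] (D :\ j) q)
       a (class_of D j q) *: vertex_prod (D :\ j) D (fun=> beta) q)
    * forest_sum k A (S :\: D) (derive_at l g).
Proof.
move=> DS jD lA.
rewrite (reindex_onto (graft D j l) (ungraft S D j)) /=; last first.
  move=> q /and3P[/andP[fq _] _]; rewrite xpair_eqE => /andP[/eqP aD /eqP qj].
  by have [] := ungraft_flow fq qj aD.
rewrite mulrC /forest_sum big_distrlr pair_big /=; apply: eq_big => -[q1 q2] /=.
  apply/idP/idP; last first.
    move=> /andP[/andP[f1 ck] f2].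
    rewrite (graft_flow AS DS jD lA f1 f2) (cuts_graft AS DS jD lA f1 f2).
    rewrite cardsU1 (eqP ck) !inE jD /= eqxx /=.
    rewrite (above_graft l AS DS jD f1 f2) graft_root eqxx.
    by rewrite (graftK l AS DS jD f1 f2) !eqxx.
  case/andP=> /and3P[/andP[fq ck] _].
  rewrite xpair_eqE => /andP[/eqP aD /eqP qj] /eqP qK.
  have [f1 f2 _] := ungraft_flow fq qj aD; rewrite qK /= in f1 f2.
  rewrite f1 f2 andbT /=; move: ck; rewrite (cuts_graft AS DS jD lA f1 f2).
  by rewrite cardsU1 !inE jD.
case/andP=> /and3P[/andP[fq ck] _].
rewrite xpair_eqE => /andP[/eqP aD /eqP qj] /eqP qK.
have [f1 f2 _] := ungraft_flow fq qj aD; rewrite qK /= in f1 f2.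
exact: forest_term_graft.
Qed.

(* Each forest with k + 1 branches is counted once for each of its branches. *)
Lemma forest_sumS k :
  k.+1%:R *: forest_sum k.+1 A S g =
  \sum_(D : {set U} | D \subset S) labeled_sum a D *
    \sum_(l in A) forest_sum k A (S :\: D) (derive_at l g).
Proof.
rewrite scaler_sumr.
transitivity (\sum_(q | flow A S q && (#|cuts A S q| == k.+1))
  \sum_(j in cuts A S q) forest_term A S g q).
  by apply: eq_bigr => q /andP[_ /eqP ck]; rewrite sumr_const ck scaler_nat.
rewrite (exchange_big_dep predT) //=.
transitivity (\sum_j \sum_(p : {set U} * U |
    [&& p.1 \subset S, j \in p.1 & p.2 \in A])
  (\sum_(q | flow [set j] (p.1 :\ j) q)
       a (class_of p.1 j q) *: vertex_prod (p.1 :\ j) p.1 (fun=> beta) q)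
    * forest_sum k A (S :\: p.1) (derive_at p.2 g)).
  apply: eq_bigr => j _.
  (* Forests in which [j] is the root of a branch are grouped by the vertex set of that branch and
     the vertex of [A] it is attached to. *)
  rewrite (partition_big (fun q => (above q j, q j))
    (fun p => [&& p.1 \subset S, j \in p.1 & p.2 \in A])) /=.
    apply: eq_bigr => -[D l] /= /and3P[DS jD lA].
    by rewrite -forest_sum_fiber //; apply: eq_bigl => q; rewrite -andbA.
  move=> q /andP[/andP[fq _]]; rewrite !inE connect0 => /andP[jS ->] /=.
  by rewrite (above_flow fq jS).
(* Summing over [j] last, for fixed [D] and [l], assembles the trees on [D] into
   [labeled_sum a D]. *)
rewrite (exchange_big_dep
  (fun p : {set U} * U => (p.1 \subset S) && (p.2 \in A))) /=.
  rewrite -(pair_big (fun D : {set U} => D \subset S) (mem A) (fun D l =>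
    \sum_(j | [&& D \subset S, j \in D & l \in A])
    (\sum_(q | flow [set j] (D :\ j) q)
       a (class_of D j q) *: vertex_prod (D :\ j) D (fun=> beta) q)
    * forest_sum k A (S :\: D) (derive_at l g))) /=.
  apply: eq_bigr => D DS; rewrite mulr_sumr; apply: eq_bigr => l lA.
  by rewrite mulr_suml; apply: eq_bigl => j; rewrite DS lA andbT.
by move=> j [D l] _ /= /and3P[-> _ ->].
Qed.

End Step.
End ForestSums.

Lemma sum_option (M : nmodType) (I : finType) (F : option I -> M) :
  \sum_o F o = F None + \sum_i F (Some i).
Proof.
rewrite (bigD1 None) //=; congr (_ + _).
rewrite (reindex_omap Some id) /=; last by case.
by apply: eq_bigl => i; rewrite eqxx.
Qed.

(** * Closed form of the weighted sum over forests *)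

Section ForestSumFormula.
Context (R : realType) (beta : fps R) (U : finType) (a : option utree -> R).
Implicit Types (A S D : {set U}) (q : {ffun U -> U}) (g : U -> fps R).
Local Notation deriv := (@fps_deriv R).

(** If no vertex of [S] is attached directly to [A], then [S] is stable under [q] and no orbit from
    [S] can reach [A]. *)
Lemma cuts_eq0 A S q : [disjoint A & S] -> flow A S q ->
  cuts A S q = set0 -> S = set0.
Proof.
move=> AS fq c0; apply/eqP/contraT => /set0Pn[k kS].
have [l lA kl] := flow_connect fq kS.
suff : l \in S by rewrite (disjointFr AS).
apply: fconnect_closed kl => // z zS.
have : z \notin cuts A S q by rewrite c0 inE.
by have := flow_codom AS fq zS; rewrite !inE zS; case: (q z \in A).
Qed.

Lemma forest_sum_set0 A g : forest_sum a 0 A set0 g = \prod_(l in A) g l.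
Proof.
have nocut q : cuts A set0 q = set0 by apply/setP => k; rewrite !inE.
rewrite /forest_sum (big_pred1 [ffun k => k]) => [|q].
  rewrite /forest_term /forest_class_weight nocut big_set0 scale1r.
  rewrite /vertex_prod setU0; apply: eq_bigr => l _.
  rewrite /indeg (_ : [set _ in _ | _] = set0) ?cards0 //.
  by apply/setP => k; rewrite !inE.
rewrite nocut cards0 andbT; apply/flowP/eqP => [[h _]|->].
  by apply/ffunP => k; rewrite ffunE h // !inE.
by split=> k; rewrite ?inE ?ffunE.
Qed.

(** Induction on [k], for all [S] and [g] at once, since cutting off a tree replaces them by
    [S :\: D] and [derive_at l g]. The hypothesis on [d] includes [D = set0], where it says that [d]
    has no constant term in [t]. *)
Lemma forest_sumE (d : fps (fps R)) k A S g :
  (forall D : {set U}, labeled_sum beta a D = #|D|`!%:R *: d.[[#|D|]]) ->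
  [disjoint A & S] -> (forall l, l \notin A -> g l = beta) ->
  k`!%:R *: forest_sum a k A S g =
  #|S|`!%:R *: ((d ^+ k).[[#|S|]] * iter k deriv (\prod_(l in A) g l)).
Proof.
move=> hd; elim: k S g => [|k IH] S g AS gbeta.
  (* Without branches [S] must be empty, which matches the coefficients of the series [1]. *)
  rewrite expr0 [X in X * _]/=; have [->|S0] := eqVneq S set0.
    by rewrite forest_sum_set0 cards0 eqxx mul1r.
  rewrite cards_eq0 (negPf S0) mul0r scaler0 scale1r /forest_sum big_pred0 // => q.
  apply/negP => /andP[fq]; rewrite cards_eq0 => /eqP/(cuts_eq0 AS fq) S0'.
  by rewrite S0' eqxx in S0.
rewrite factS mulnC natrM -scalerA (forest_sumS a AS gbeta) scaler_sumr.
transitivity (\sum_(D : {set U} | D \subset S)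
  ((#|D|`! * (#|S| - #|D|)`!)%:R *: (d.[[#|D|]] * (d ^+ k).[[#|S| - #|D|]]))
   * iter k.+1 deriv (\prod_(l in A) g l)).
  apply: eq_bigr => D DS; rewrite hd fps_scaleAr scaler_sumr.
  have cSD : #|S :\: D| = (#|S| - #|D|)%N by rewrite cardsD (setIidPr DS).
  rewrite (eq_bigr (fun l => (#|S| - #|D|)`!%:R *: ((d ^+ k).[[#|S| - #|D|]] *
    iter k deriv (\prod_(m in A) derive_at l g m)))); last first.
    move=> l lA; rewrite IH ?cSD //.
      by apply: disjointWr AS; apply: subsetDl.
    by move=> m mA; rewrite /derive_at ifN ?gbeta //; apply: contraNneq mA => ->.
  (* The sum over [l] of the products with the factor at [l] differentiated is one more derivative
     of the whole product. *)
  rewrite -scaler_sumr -mulr_sumr -iter_fps_deriv_sum -fps_deriv_prod -iterSr.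
  by rewrite -fps_scaleAr -scalerAl scalerA -natrM -scalerAl mulrA mulnC.
by rewrite -mulr_suml fps_mul_subsets exprS -scalerAl.
Qed.

End ForestSumFormula.

(** * Sums over pairs of a tree and a subtree *)

Section SubtreeSum.
Context (R : realType) (beta : fps R) (U : finType) (a b : option utree -> R).
Implicit Types (A S D : {set U}) (q : {ffun U -> U}) (g : U -> fps R).
Implicit Types (T : rtree U).
Local Notation deriv := (@fps_deriv R).

Lemma carry_id T : carry id T = [ffun k => par T k].
Proof. by apply/ffunP => k; rewrite (carryE (@inj_id U)) ffunE. Qed.

Lemma restrictable_root T A : restrictable T A (root T) =
  (root T \in A) && [forall k in A, par T k \in A].
Proof.
apply: andb_id2l => rA; apply/subsetP/forall_inP => h k.
  move=> kA; have [->|kr] := eqVneq k (root T); first by rewrite par_root.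
  have := h (parent T k); rewrite imset_f ?inE ?kr // => /(_ isT)/imsetP[l lA].
  by rewrite /par => ->.
case/imsetP=> l /setD1P[lr lA] ->; rewrite parentE (negPf lr).
by apply: imset_f; apply: h.
Qed.

Lemma subtree_weight T A (h : restrictable T A (root T)) :
  b (subtree_class (Some (exist _ A h))) *
    forest_weight a (difference_forest (Some (exist _ A h))) =
  b (class_of A (root T) (carry id T)) *
    forest_class_weight a A (~: A) (carry id T).
Proof.
rewrite carry_id (class_of_realizes (restrict_realizes h)); congr (_ * _).
  congr (b (Some (unlabel (restrict _)))); exact: bool_irrelevance.
rewrite /forest_weight /= big_map big_filter big_enum_cond /=.
have rA : root T \in A by case/andP: h.
apply: eq_big => j.
  rewrite !inE ffunE; have [//|jA] /= := boolP (j \in A).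
  rewrite parentE ifN; last by apply: contraNneq jA => ->.
  by rewrite mem_imset // => ? ? [].
move=> _; congr a; rewrite -descendants_above.
by rewrite (class_of_realizes (restrict_realizes (branch_subproof T j))).
Qed.

Lemma subtree_sum_flow T : subtree_sum a b T =
  b None * a (Some (unlabel T)) +
  \sum_(A : {set U} | (root T \in A) &&
      [forall k in A, carry id T k \in A])
    b (class_of A (root T) (carry id T)) *
      forest_class_weight a A (~: A) (carry id T).
Proof.
rewrite /subtree_sum sum_option; congr (_ + _).
  by rewrite /forest_weight /= big_seq1.
rewrite (reindex_omap (J := subtree T) (fun A : subtree T => sval A)
  (fun A => insub A)) /=; last first.
  move=> A /andP[rA /forall_inP cA]; rewrite insubT //= restrictable_root rA.
  by apply/forall_inP => k kA; have := cA k kA; rewrite carry_id ffunE.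
apply: eq_big => [[A h]|[A h] _]; last exact: subtree_weight.
rewrite valK eqxx andbT; have := h; rewrite restrictable_root => /andP[-> ].
by move=> /forall_inP cA; apply/esym/forall_inP => k /cA; rewrite carry_id ffunE.
Qed.

(** Children split into those in [A], whose derivatives are absorbed into the factor, and those
    outside, counted by [q1]. A vertex outside [A] has no child in [A], so its factor stays
    [beta]. *)
Lemma vertex_prod_overlay A r q0 q1 : r \in A ->
  flow [set r] (A :\ r) q0 -> flow A (~: A) q1 ->
  vertex_prod (~: [set r]) setT (fun=> beta) (overlay A (q0, q1)) =
  vertex_prod (~: A) (A :|: ~: A)
    (fun l => if l \in A then iter (indeg (A :\ r) q0 l) deriv beta else beta) q1.
Proof.
move=> rA f0 f1; rewrite /vertex_prod setUCr; apply: eq_bigr => l _.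
rewrite (indeg_overlay rA q1 f0) addnC iterD; congr (iter _ _ _).
case: ifPn => // lA; rewrite /indeg
  (_ : [set k in A :\ r | q0 k == l] = set0) ?cards0 //.
apply/setP => k; rewrite !inE; apply/negP => /andP[/andP[_ kA] /eqP q0k].
by have [_] := overlay_in rA q1 f0 kA; rewrite q0k (negPf lA).
Qed.

Lemma sum_overlay (M : nmodType) A r (F : {ffun U -> U} -> M) : r \in A ->
  \sum_(q | flow [set r] (~: [set r]) q && [forall k in A, q k \in A]) F q =
  \sum_(q0 | flow [set r] (A :\ r) q0) \sum_(q1 | flow A (~: A) q1)
    F (overlay A (q0, q1)).
Proof.
move=> rA; rewrite (reindex_onto (overlay A) (unoverlay A r)) /=; last first.
  by move=> q /andP[fq /forall_inP qA]; have [] := unoverlay_flow rA fq qA.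
rewrite pair_big /=; apply: eq_big => [[q0 q1]|[q0 q1] _] //=.
apply/idP/andP => [/andP[/andP[fq /forall_inP qA] /eqP qK]|[f0 f1]].
  by have [f0 f1 _] := unoverlay_flow rA fq qA; rewrite qK in f0 f1.
rewrite (overlay_flow rA f0 f1) (overlayK rA f0 f1) eqxx andbT.
exact/forall_inP/(overlay_closed rA q1 f0).
Qed.

Lemma sum_flow_cuts A g :
  \sum_(q | flow A (~: A) q) forest_term a A (~: A) g q =
  \sum_(k < #|~: A|.+1) forest_sum a k A (~: A) g.
Proof.
rewrite (partition_big
  (fun q => inord #|cuts A (~: A) q| : 'I_#|~: A|.+1) predT) //=.
apply: eq_bigr => k _; apply: eq_bigl => q; congr (_ && _).
rewrite -val_eqE /= inordK // ltnS; apply: subset_leq_card.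
by apply/subsetP => j; rewrite inE => /andP[].
Qed.

(** The first summand is the empty subtree. For the rest, pairs of a tree and a subtree become
    quadruples of a set [A], a root, a tree [q0] on [A] and a flow [q1] into [A]; [forest_sumE] sums
    over [q1], and linearity of the derivative then sums over [q0]. *)
Lemma sum_subtrees (d : fps (fps R)) :
  (forall D : {set U}, labeled_sum beta a D = #|D|`!%:R *: d.[[#|D|]]) ->
  \sum_(T : rtree U) subtree_sum a b T *: tree_term beta T =
  b None *: \sum_(T : rtree U) a (Some (unlabel T)) *: tree_term beta T +
  \sum_(A : {set U}) \sum_(k < #|~: A|.+1) (#|~: A|`!%:R / k`!%:R) *:
     ((d ^+ k).[[#|~: A|]] * iter k deriv (labeled_sum beta b A)).
Proof.
move=> hd; under eq_bigr do rewrite subtree_sum_flow scalerDl -scalerA.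
rewrite big_split /= -scaler_sumr; congr (_ + _).
pose G r q := (\sum_(A : {set U} | (r \in A) && [forall k in A, q k \in A])
    b (class_of A r q) * forest_class_weight a A (~: A) q) *:
  vertex_prod (~: [set r]) setT (fun=> beta) q.
have idT : id @: [set: U] = setT by rewrite imset_id.
transitivity (\sum_(T : rtree U) G (root T) (carry id T)).
  apply: eq_bigr => T _; rewrite /G (tree_term_carry beta (@inj_id U)).
  by rewrite idT setTD.
rewrite (sum_carry (@inj_id U)) idT.
(* The vertex set of the subtree becomes the outermost variable, with root and flow ranging over the
   trees for which it is a subtree. *)
transitivity (\sum_(A : {set U}) \sum_(r in A)
  \sum_(q | flow [set r] (~: [set r]) q && [forall k in A, q k \in A])
    (b (class_of A r q) * forest_class_weight a A (~: A) q) *: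
    vertex_prod (~: [set r]) setT (fun=> beta) q).
  rewrite [RHS](exchange_big_dep predT) //= big_mkcond /=.
  apply: eq_bigr => r _; rewrite inE setTD.
  rewrite [RHS](exchange_big_dep (flow [set r] (~: [set r]))) /=; last first.
    by move=> A q _ /andP[].
  apply: eq_bigr => q fq; rewrite /G scaler_suml; apply: eq_bigl => A.
  by rewrite fq.
apply: eq_bigr => A _.
transitivity (\sum_(r in A) \sum_(q0 | flow [set r] (A :\ r) q0)
  b (class_of A r q0) *: \sum_(k < #|~: A|.+1) (#|~: A|`!%:R / k`!%:R) *:
     ((d ^+ k).[[#|~: A|]] *
        iter k deriv (vertex_prod (A :\ r) A (fun=> beta) q0))).
  apply: eq_bigr => r rA; rewrite sum_overlay //; apply: eq_bigr => q0 f0.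
  pose g l := if l \in A then iter (indeg (A :\ r) q0 l) deriv beta else beta.
  transitivity (b (class_of A r q0) *:
    \sum_(q1 | flow A (~: A) q1) forest_term a A (~: A) g q1).
    rewrite scaler_sumr; apply: eq_bigr => q1 f1.
    rewrite vertex_prod_overlay // scalerA; congr (_ * _ *: _).
      congr (b _); apply: eq_class_of => k /setD1P[_ kA].
      by have [->] := overlay_in rA q1 f0 kA.
    rewrite /forest_class_weight (cuts_overlay A q0 q1).
    apply: eq_bigr => j; rewrite !inE => /andP[jA _].
    rewrite (above_overlay rA f0 f1 jA); congr (a _).
    apply: eq_class_of => k /setD1P[_ kj]; rewrite overlay_out //.
    have := subsetP (above_flow f1 (_ : j \in ~: A)) _ kj.
    by rewrite !inE; apply.
  congr (_ *: _); rewrite sum_flow_cuts; apply: eq_bigr => k _.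
  have k0 : k`!%:R != 0 :> R by rewrite pnatr_eq0 -lt0n fact_gt0.
  (* [forest_sumE] gives [k!] times the forest sum, and [k!] is invertible in [R]. *)
  apply: (scalerI k0); rewrite scalerA mulrCA divff // mulr1.
  rewrite (forest_sumE _ hd) //; last by move=> l lA; rewrite /g (negPf lA).
    congr (_ *: (_ * iter _ _ _)); apply: eq_bigr => l lA.
    by rewrite /g lA.
  by rewrite -setI_eq0 setICr.
transitivity (\sum_(k < #|~: A|.+1) \sum_(r in A)
    \sum_(q0 | flow [set r] (A :\ r) q0)
  b (class_of A r q0) *: ((#|~: A|`!%:R / k`!%:R) *:
     ((d ^+ k).[[#|~: A|]] *
        iter k deriv (vertex_prod (A :\ r) A (fun=> beta) q0)))).
  rewrite [RHS]exchange_big /=; apply: eq_bigr => r _.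
  by rewrite [RHS]exchange_big /=; apply: eq_bigr => q0 _; rewrite scaler_sumr.
apply: eq_bigr => k _.
rewrite /labeled_sum iter_fps_deriv_sum mulr_sumr scaler_sumr.
apply: eq_bigr => r rA; rewrite iter_fps_deriv_sum mulr_sumr scaler_sumr.
apply: eq_bigr => q _; rewrite iter_fps_derivZ -fps_scaleAr !scalerA.
by rewrite mulrC.
Qed.

End SubtreeSum.

(** * The substitution formula *)

Section Assembly.
Context (R : realType) (beta : fps R).
Local Notation deriv := (@fps_deriv R).

Lemma fps_taylor0 (h : fps R) (d : fps (fps R)) : (fps_taylor h d).[[0]] = h.
Proof. by rewrite /= big_ord1 /= invr1 scale1r mulr1. Qed.

Lemma coef_fps_subst (F u : fps (fps R)) n : (fps_subst F u).[[n]] =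
  \sum_(m < n.+1) (fps_taylor F.[[m]] (u - fpsC fpsX)).[[n - m]].
Proof. by []. Qed.

Lemma coef_fps_taylor (h : fps R) (d : fps (fps R)) n :
  (fps_taylor h d).[[n]] =
  \sum_(k < n.+1) (k`!%:R^-1 : R) *: (iter k deriv h * (d ^+ k).[[n]]).
Proof. by []. Qed.

(** The expansion of a linear series ends after the first order, and its term of order zero only
    affects the constant coefficient in [t]. *)
Lemma fps_taylor_X (x : R) (d : fps (fps R)) n :
  (fps_taylor (x *: fpsX) d).[[n.+1]] = x *: d.[[n.+1]].
Proof.
have D1 : deriv fpsX = 1.
  by apply/fpsP => -[|[|i]] /=; rewrite ?mulr1n ?mul0rn.
rewrite [LHS]/= big_ord_recl [X in _ * X](_ : _ = 0) // mulr0 scaler0 add0r.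
rewrite big_ord_recl big1 => [|k _]; last first.
  rewrite !lift0 !iterSr fps_derivZ D1 fps_derivZ fps_deriv1 scaler0.
  by rewrite iter_fps_deriv0 mul0r scaler0.
by rewrite addr0 /= invr1 scale1r fps_derivZ D1 -scalerAl mul1r.
Qed.

Lemma tree_series_pos (c : option utree -> R) n :
  n.+1`!%:R *: (tree_series beta c).[[n.+1]] =
  \sum_(T : rtree 'I_n.+1) c (Some (unlabel T)) *: tree_term beta T.
Proof.
by rewrite /= scalerA divff ?scale1r // pnatr_eq0 -lt0n fact_gt0.
Qed.

(** Coefficients of [t] are compared after multiplication by a factorial. The empty subtree matches
    the term [m = 0] of the substitution, and subtrees with [m] vertices match the term [m > 0]. *)
Lemma tree_series_subtree_conv (a b : option utree -> R) : a None = 1 ->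
  tree_series beta (subtree_conv a b) =
  fps_subst (tree_series beta b) (tree_series beta a).
Proof.
move=> a1; set d : fps (fps R) := tree_series beta a - fpsC fpsX.
(* By [a None = 1] the constant terms cancel, so [d] is of order [t]. *)
have d0 : d.[[0]] = 0 by rewrite /= a1 scale1r subrr.
have dS n : d.[[n.+1]] = (tree_series beta a).[[n.+1]] by rewrite /= subr0.
apply/fpsP => -[|n].
  by rewrite coef_fps_subst big_ord1 fps_taylor0.
have n0 : n.+1`!%:R != 0 :> R by rewrite pnatr_eq0 -lt0n fact_gt0.
have hd (D : {set 'I_n.+1}) : labeled_sum beta a D = #|D|`!%:R *: d.[[#|D|]].
  have [->|D0] := eqVneq D set0; first by rewrite labeled_sum0 cards0 d0 scaler0.
  rewrite labeled_sum_series //; move: D0; rewrite -card_gt0.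
  by case: #|D| => // m _; rewrite dS.
apply: (scalerI n0); rewrite tree_series_pos.
under eq_bigr do rewrite subtree_conv_unlabel.
rewrite (sum_subtrees b hd) coef_fps_subst big_ord_recl.
rewrite scalerDr subn0 -/d; congr (_ + _).
  rewrite -tree_series_pos -dS [_.[[0]]]/=.
  by rewrite fps_taylor_X !scalerA mulrC.
(* [F] vanishes at [0], like the sum over trees on the empty set; the constant coefficient of the
   series of [b] is already accounted for by the empty subtree. *)
pose F m := if m is m'.+1 then (tree_series beta b).[[m'.+1]] else 0.
have hb (A : {set 'I_n.+1}) : labeled_sum beta b A = #|A|`!%:R *: F #|A|.
  have [->|A0] := eqVneq A set0; first by rewrite labeled_sum0 cards0 scaler0.
  rewrite labeled_sum_series //; move: A0; rewrite -card_gt0.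
  by case: #|A|.
pose G m := \sum_(k < (n.+1 - m).+1) ((n.+1 - m)`!%:R / k`!%:R) *:
  ((d ^+ k).[[n.+1 - m]] * iter k deriv (m`!%:R *: F m)).
transitivity (\sum_(A : {set 'I_n.+1} | A \subset setT) G #|A|).
  apply: eq_big => [A|A _]; first by rewrite subsetT.
  by rewrite hb cardsCs setCK card_ord.
(* Grouping the sets [A] by size produces binomial coefficients; the empty set drops out because
   [F 0 = 0]. *)
rewrite sum_subsets_card cardsT card_ord scaler_sumr big_ord_recl.
rewrite {1}/G big1 ?mul0rn ?add0r => [|k _]; last first.
  by rewrite scaler0 iter_fps_deriv0 mulr0 scaler0.
apply: eq_bigr => m _; rewrite lift0.
have mn : (m.+1 <= n.+1)%N := ltn_ord m.
rewrite -(@scaler_nat R) coef_fps_taylor /G !scaler_sumr.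
apply: eq_bigr => k _; rewrite iter_fps_derivZ -fps_scaleAr !scalerA.
rewrite [(_ ^+ k).[[_]] * _]mulrC; congr (_ *: _).
(* The scalars agree since [(n + 1)!] is the binomial coefficient times [(m + 1)!] and
   [(n - m)!]. *)
rewrite -(bin_fact mn); move: (m.+1`!) ((n.+1 - m.+1)`!) => x y.
rewrite !natrM -!mulrA; congr (_ * _).
by rewrite mulrA mulrC.
Qed.
End Assembly.

Theorem mainTheorem10 (R : realType) (beta : fps R)
    (a b c : option utree -> R) (ha : a None = 1%R)
    (hc : c = subtree_conv a b) :
  tree_series beta c = fps_subst (tree_series beta b) (tree_series beta a).
Proof. by rewrite hc tree_series_subtree_conv. Qed.
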